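(* Let $\mathbb{F}_2$ be any subgroup of $\mathrm{SL}(2,\mathbb{Z})$ that is free of rank two, and let $\mathbb{F}_2 \ltimes \mathbb{Z}^2$ be the semidirect product in which $\mathbb{F}_2$ acts on $\mathbb{Z}^2$ by its standard linear action by matrices. The group $\mathbb{F}_2 \ltimes \mathbb{Z}^2$ is locally indicable, and it does not embed into $\mathrm{Diff}^1_+(]0,1[)$; that is, there is no injective group homomorphism $\mathbb{F}_2 \ltimes \mathbb{Z}^2 \to \mathrm{Diff}^1_+(]0,1[)$.
   Context: $\mathrm{Diff}^1_+(]0,1[)$ denotes the group, under composition, of orientation-preserving $C^1$ diffeomorphisms of the open interval $]0,1[ = (0,1)$ (bijections of class $C^1$ with inverse of class $C^1$, with no condition at the endpoints). A group is locally indicable if each of its non-trivial finitely generated subgroups admits a surjective homomorphism onto $\mathbb{Z}$. A matrix $f=\begin{pmatrix} a & b\\ c & d\end{pmatrix}\in \mathrm{SL}(2,\mathbb{Z})$ acts on $\mathbb{Z}^2$ by $f(1,0)=(a,c)$ and $f(0,1)=(b,d)$. In the semidirect product, $\mathbb{Z}^2$ is the normal factor and conjugation by elements of $\mathbb{F}_2$ induces this action. *)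

(* Defs.v *)
From HB Require Import structures.
From mathcomp Require Import all_boot all_order all_algebra.
From mathcomp Require Import all_classical all_reals all_analysis.
Import Order.TTheory GRing.Theory Num.Theory.
Import numFieldNormedType.Exports.

Set Implicit Arguments.
Unset Strict Implicit.
Unset Printing Implicit Defensive.

Local Open Scope classical_set_scope.
Local Open Scope ring_scope.

Section SubgroupType.
Variables (G : groupType) (H : groupClosed G).

Record subgroup_of := SubgroupOf {
  subgroup_val : G;
  _ : subgroup_val \in (H : {pred G}) }.

HB.instance Definition _ := [isSub for subgroup_val].
HB.instance Definition _ := [Choice of subgroup_of by <:].

Fact subgroup_of_closed : group_closed (H : {pred G}).
Proof. by split; [exact: gpred1 | exact: gpredF]. Qed.

HB.instance Definition _ :=
  SubChoice_isSubGroup.Build G (H : {pred G}) subgroup_of subgroup_of_closed.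

End SubgroupType.

Definition finitely_generated (G : groupType) (H : groupClosed G) : Prop :=
  exists2 s : seq G, {subset s <= (H : {pred G})} &
    forall K : groupClosed G,
      {subset s <= (K : {pred G})} -> {subset (H : {pred G}) <= (K : {pred G})}.

(** [Algebra.to_multiplicative int] is the additive group of integers, seen as a
    [groupType]. *)
Definition locally_indicable (G : groupType) : Prop :=
  forall H : groupClosed G,
    finitely_generated H ->
    (exists2 x : G, x \in (H : {pred G}) & x <> 1%g) ->
    exists phi : {multiplicative subgroup_of H -> Algebra.to_multiplicative int},
      forall n : Algebra.to_multiplicative int, exists x, phi x = n.

Section FreeBasis.
Variables (G : groupType) (n : nat) (X : 'I_n -> G).

(** The letter [(i, false)] stands for the generator [X i] and [(i, true)] for
    its inverse. *)
Definition letter_val (l : 'I_n * bool) : G :=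
  if l.2 then ((X l.1)^-1)%g else X l.1.

Definition word_val (w : seq ('I_n * bool)) : G :=
  (\prod_(l <- w) letter_val l)%g.

Definition reduced (w : seq ('I_n * bool)) : bool :=
  sorted (fun l m => ~~ ((l.1 == m.1) && (l.2 != m.2))) w.

Definition free_basis : Prop :=
  forall g : G, exists! w, reduced w /\ word_val w = g.

End FreeBasis.

Definition free_of_rank (n : nat) (G : groupType) : Prop :=
  exists X : 'I_n -> G, free_basis X.

Record SL2Z := MkSL2Z { SL2Z_val :> 'M[int]_2; _ : \det SL2Z_val == 1 }.

HB.instance Definition _ := [isSub for SL2Z_val].
HB.instance Definition _ := [Choice of SL2Z by <:].

Section SL2ZGroup.
Implicit Types A B : SL2Z.

Fact SL2Z_det A : \det A = 1. Proof. exact/eqP/(valP A). Qed.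

Fact SL2Z_one_subproof : \det (1%:M : 'M[int]_2) == 1.
Proof. by rewrite det1. Qed.

Fact SL2Z_mul_subproof A B : \det (A *m B) == 1.
Proof. by rewrite det_mulmx !SL2Z_det mulr1. Qed.

Fact SL2Z_inv_subproof A : \det (\adj A) == 1.
Proof.
have := congr1 determinant (mul_mx_adj A).
by rewrite det_mulmx SL2Z_det mul1r det1 => ->.
Qed.

Definition SL2Z_one := MkSL2Z SL2Z_one_subproof.
Definition SL2Z_mul A B := MkSL2Z (SL2Z_mul_subproof A B).
Definition SL2Z_inv A := MkSL2Z (SL2Z_inv_subproof A).

Fact SL2Z_mulA : associative SL2Z_mul.
Proof. by move=> A B C; apply/val_inj; rewrite /= mulmxA. Qed.

Fact SL2Z_mul1 : left_id SL2Z_one SL2Z_mul.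
Proof. by move=> A; apply/val_inj; rewrite /= mul1mx. Qed.

Fact SL2Z_mulr1 : right_id SL2Z_one SL2Z_mul.
Proof. by move=> A; apply/val_inj; rewrite /= mulmx1. Qed.

Fact SL2Z_mulV : left_inverse SL2Z_one SL2Z_inv SL2Z_mul.
Proof. by move=> A; apply/val_inj; rewrite /= mul_adj_mx SL2Z_det. Qed.

Fact SL2Z_mulrV : right_inverse SL2Z_one SL2Z_inv SL2Z_mul.
Proof. by move=> A; apply/val_inj; rewrite /= mul_mx_adj SL2Z_det. Qed.

HB.instance Definition _ :=
  isGroup.Build SL2Z SL2Z_mulA SL2Z_mul1 SL2Z_mulr1 SL2Z_mulV SL2Z_mulrV.

End SL2ZGroup.

(** Elements of Z^2 are column vectors, so that [f *m v] sends the first (resp.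
    second) basis vector to the first (resp. second) column of [f].  The pair
    [(v, f)] stands for the product of [v] by [f], whence the law
    [(v, f) (w, g) = (v + f w, f g)], for which conjugation of [(w, 1)] by
    [(0, f)] is [(f w, 1)]. *)

Section SemidirectProduct.
Variable F : groupClosed SL2Z.

Definition semidirect : Type := ('cV[int]_2 * subgroup_of F)%type.

HB.instance Definition _ := Choice.on semidirect.

Implicit Types x y : semidirect.

Definition act (f : subgroup_of F) (v : 'cV[int]_2) : 'cV[int]_2 :=
  (val f : SL2Z) *m v.

Fact act1 v : act 1%g v = v.
Proof. by rewrite /act val1 /= mul1mx. Qed.

Fact actM f g v : act (f * g)%g v = act f (act g v).
Proof. by rewrite /act valM /= mulmxA. Qed.

Fact actD f v w : act f (v + w) = act f v + act f w.
Proof. exact: mulmxDr. Qed.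

Fact actN f v : act f (- v) = - act f v.
Proof. exact: mulmxN. Qed.

Definition sd_one : semidirect := (0, 1%g).
Definition sd_mul x y : semidirect := (x.1 + act x.2 y.1, (x.2 * y.2)%g).
Definition sd_inv x : semidirect := (- act (x.2^-1)%g x.1, (x.2^-1)%g).

Fact sd_mulA : associative sd_mul.
Proof.
move=> x y z; congr pair; last exact: mulgA.
by rewrite /= actM actD addrA.
Qed.

Fact sd_mul1 : left_id sd_one sd_mul.
Proof. by case=> v f; rewrite /sd_mul /= act1 add0r mul1g. Qed.

Fact sd_mulr1 : right_id sd_one sd_mul.
Proof. by case=> v f; rewrite /sd_mul /= /act mulmx0 addr0 mulg1. Qed.

Fact sd_mulV : left_inverse sd_one sd_inv sd_mul.
Proof. by case=> v f; rewrite /sd_mul /= addNr mulVg. Qed.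

Fact sd_mulrV : right_inverse sd_one sd_inv sd_mul.
Proof.
by case=> v f; rewrite /sd_mul /= actN -actM mulgV act1 addrN.
Qed.

HB.instance Definition _ :=
  isGroup.Build semidirect sd_mulA sd_mul1 sd_mulr1 sd_mulV sd_mulrV.

End SemidirectProduct.

Section Diff1.
Variable R : realType.
Implicit Types f g : R -> R.

(** A self-map of ]0,1[ is encoded as the function [R -> R] that extends it by
    the identity outside ]0,1[, so that Leibniz equality is equality on ]0,1[.
    As ]0,1[ is open, the extension plays no role in the derivatives below, and
    nothing is required at the points 0 and 1. *)
Definition self_map01 f : Prop :=
  (forall x, x \in `]0, 1[ -> f x \in `]0, 1[) /\
  (forall x, x \notin `]0, 1[ -> f x = x).

Definition C1_on01 f : Prop :=
  forall x, x \in `]0, 1[ -> derivable f x 1 /\ {for x, continuous (derive1 f)}.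

Definition diffeo01 f : Prop :=
  [/\ self_map01 f, C1_on01 f,
      {in `]0, 1[ &, {homo f : x y / x < y}} &
      exists g, [/\ self_map01 g, C1_on01 g, cancel f g & cancel g f]].

Record diff1 := MkDiff1 { diff1_val :> R -> R; _ : `[< diffeo01 diff1_val >] }.

HB.instance Definition _ := [isSub for diff1_val].
HB.instance Definition _ := [Choice of diff1 by <:].

Fact self_map01_comp f g : self_map01 f -> self_map01 g -> self_map01 (f \o g).
Proof.
move=> [fI fO] [gI gO]; split=> x xI /=; first exact/fI/gI.
by rewrite gO // fO.
Qed.

Fact C1_on01_comp f g :
  self_map01 g -> C1_on01 f -> C1_on01 g -> C1_on01 (f \o g).
Proof.
move=> [gI _] fC gC x xI; have [gd gc] := gC _ xI.
have [fd fc] := fC _ (gI _ xI).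
have gd' : differentiable g x by move/derivable1_diffP: gd.
have fd' : differentiable f (g x) by move/derivable1_diffP: fd.
split; first by apply/derivable1_diffP; exact: differentiable_comp gd' fd'.
have E : \forall y \near x, derive1 f (g y) * derive1 g y = derive1 (f \o g) y.
  near=> y; have yI : y \in `]0, 1[ by near: y; exact: near_in_itvoo.
  by rewrite [RHS]derive1_comp; [| exact: (gC _ yI).1 | exact: (fC _ (gI _ yI)).1].
have gx : {for x, continuous g} := differentiable_continuous gd'.
rewrite /prop_for /continuous_at -(nbhs_singleton E).
apply: cvg_trans (near_eq_cvg E) _.
exact: cvgM (@continuous_comp _ _ _ g (derive1 f) x gx fc) gc.
Unshelve. all: by end_near. Qed.

Fact diffeo01_id : diffeo01 idfun.
Proof.
have C : C1_on01 idfun.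
  move=> x _; split; first exact: derivable_id.
  have -> : derive1 (idfun : R -> R) = cst 1 by apply/funext => y; exact: derive1_id.
  exact: cvg_cst.
by split=> //; exists idfun.
Qed.

Fact diffeo01_comp f g : diffeo01 f -> diffeo01 g -> diffeo01 (f \o g).
Proof.
move=> [fs fC fm [f' [f's f'C fK f'K]]] [gs gC gm [g' [g's g'C gK g'K]]].
split; [exact: self_map01_comp | exact: C1_on01_comp | | ].
  by move=> x y xI yI /(gm _ _ xI yI) /fm; apply; exact: gs.1.
exists (g' \o f'); split; [exact: self_map01_comp | exact: C1_on01_comp | | ].
  exact: can_comp fK gK.
exact: can_comp g'K f'K.
Qed.

Fact diff1P (f : diff1) : diffeo01 f. Proof. exact/asboolP/(valP f). Qed.

Definition diff1_inv_fun (f : diff1) : R -> R :=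
  let: And4 _ _ _ ex := diff1P f in projT1 (cid ex).

Fact diff1_inv_funP (f : diff1) :
  [/\ diffeo01 (diff1_inv_fun f), cancel f (diff1_inv_fun f)
    & cancel (diff1_inv_fun f) f].
Proof.
rewrite /diff1_inv_fun; case: (diff1P f) => fs fC fm ex.
case: (cid ex) => g /= [gs gC fK gK]; split=> //.
split=> //; last by exists f.
move=> x y xI yI; apply: contraTT; rewrite -!leNgt le_eqVlt => /orP[/eqP e|lt].
  by rewrite -(gK x) -(gK y) e.
by rewrite -(gK x) -(gK y) ltW // fm //; exact: gs.1.
Qed.

Definition diff1_one : diff1 := MkDiff1 (asboolT diffeo01_id).
Definition diff1_mul (f g : diff1) : diff1 :=
  MkDiff1 (asboolT (diffeo01_comp (diff1P f) (diff1P g))).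
Definition diff1_inv (f : diff1) : diff1 :=
  let: And3 p _ _ := diff1_inv_funP f in MkDiff1 (asboolT p).

Fact diff1_invE (f : diff1) : diff1_inv f = diff1_inv_fun f :> (R -> R).
Proof. by rewrite /diff1_inv; case: (diff1_inv_funP f). Qed.

Fact diff1_mulA : associative diff1_mul.
Proof. by move=> ? ? ?; exact/val_inj. Qed.

Fact diff1_mul1 : left_id diff1_one diff1_mul.
Proof. by move=> ?; exact/val_inj. Qed.

Fact diff1_mulr1 : right_id diff1_one diff1_mul.
Proof. by move=> ?; exact/val_inj. Qed.

Fact diff1_mulV : left_inverse diff1_one diff1_inv diff1_mul.
Proof.
move=> f; apply/val_inj/funext => x /=; rewrite diff1_invE.
by have [_ fK _] := diff1_inv_funP f; exact: fK.
Qed.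

Fact diff1_mulrV : right_inverse diff1_one diff1_inv diff1_mul.
Proof.
move=> f; apply/val_inj/funext => x /=; rewrite diff1_invE.
by have [_ _ fK] := diff1_inv_funP f; exact: fK.
Qed.

HB.instance Definition _ := isGroup.Build diff1
  diff1_mulA diff1_mul1 diff1_mulr1 diff1_mulV diff1_mulrV.

End Diff1.

(* Main.v *)
Require Import Defs.
From HB Require Import structures.
From mathcomp Require Import all_boot all_order all_algebra.
From mathcomp Require Import all_classical all_reals all_analysis.
From mathcomp Require Import zify ring lra.

Set Implicit Arguments.
Unset Strict Implicit.
Unset Printing Implicit Defensive.

Import Order.TTheory GRing.Theory Num.Theory.
Import numFieldNormedType.Exports.
Local Open Scope ring_scope.

(** Local indicability.  The Magnus expansion sends the generator [x_i] of a free
    group to the non-commutative power series [1 + x_i]; it is injective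
    ([word_mul_neq1]).  If a subgroup of the semidirect product has a non-trivial
    image in [F], let [d] be the lowest positive degree in which the expansion of
    some element of the image has a nonzero coefficient.  Products add up the
    coefficients of degree [d] ([magnus_lowest]), so one of these coefficients is a
    nonzero homomorphism to the integers.  The other subgroups lie in Z^2, and a
    coordinate does the job.

    Non-embedding.  Suppose that the group acts faithfully by C^1 diffeomorphisms,
    [T v] for [v] in Z^2 and [A f] for [f] in [F], so that
    [A f T v = T (f v) A f].  Let [I] be the convex hull of a non-trivial orbit of
    Z^2, an interval whose endpoints are fixed by all the [T v].  On [I] the group
    Z^2 acts by translations up to semi-conjugacy: there is a nonzero linear form
    [tau] such that a small interval [D] of [I] is disjoint from its image under
    [T v] as soon as [|tau v| >= 3], and an [f] that preserves [I] multiplies [tau]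
    by a constant ([translation_number]).

    Suppose that [s = A g], with [g] hyperbolic, moves [I] off itself, that the
    intervals [s^n I] shrink to a point [p] of ]0,1[, and that [tau] is not an
    eigenform of [g].  For one of the two basis vectors [v], which may depend on [n],
    [|tau (g^-n v)|] is then large, and at least doubles from [n] to [n + 1]
    ([recurrence_growth]): [T v] acts on [s^n I] like a translation of exponentially
    large length on [I].  Consider the products of [n] factors, each equal to [s] or
    to [s T v].  They map [s^K D] to [2^n] intervals contained in [s^(K+n) I], which
    are disjoint because [tau] takes distant values on the [2^n] partial sums of the
    vectors [g^-k v] ([doubling_sum]).  Near [p], the derivative of [s] is nearly the
    positive constant [s' p], and the derivative of [T v] is nearly 1 because [T v]
    fixes the endpoints of all [s^k I].  Up to fixed factors, each of the [2^n] images
    is therefore longer than [(c s' p)^n], for a constant [c < 1] as close to 1 as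
    desired, while the interval containing them is shorter than [(s' p / c)^n].  This
    is absurd for large [n] ([no_doubling]).

    It remains to find [g].  Hoelder's theorem ([free_action_abelian]) provides a
    non-trivial element of [F] with a fixed point in ]0,1[.  If it is not hyperbolic,
    then its square is unipotent; a power of it, multiplied by a conjugate of its
    square or by the inverse of this conjugate, is hyperbolic, and one of the two
    products has a fixed point since both factors have one ([fixed_mul_or_div]).  This
    gives a hyperbolic [f] with a fixed point ([hyperbolic_fixed_point]).  As [F] is
    free of rank two, [tau] cannot be an eigenform of all the conjugates of [f]
    ([conjugate_not_eigenform]).  A conjugate of which it is not an eigenform does not
    preserve [I], hence moves [I] off itself, and a fixed point of this conjugate
    stops the images of [I] under its positive or negative powers inside ]0,1[. *)

(** * The Magnus expansion and local indicability *)

Section Magnus.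
Variable n : nat.
Implicit Types (i j : 'I_n) (s t : seq 'I_n -> int) (m k : seq 'I_n).
Implicit Types (l : 'I_n * bool) (w : seq ('I_n * bool)).

(** A formal power series in the non-commuting variables [x_i] is its family of
    coefficients; this is the product of [1 + x_i] by [s]. *)
Definition mul_gen i s m : int :=
  s m + (if m is j :: m' then if j == i then s m' else 0 else 0).

(** The product of the inverse of [1 + x_i] by [s]. *)
Fixpoint div_gen i s m : int :=
  s m - (if m is j :: m' then if j == i then div_gen i s m' else 0 else 0).

Definition letter_mul l s := if l.2 then div_gen l.1 s else mul_gen l.1 s.

Definition word_mul w s := foldr letter_mul s w.

Definition series1 m : int := (m == [::])%:R.

Lemma mul_genK i : cancel (mul_gen i) (div_gen i).
Proof.
move=> s; apply/funext; elim=> [|j m IH] /=; rewrite /mul_gen ?addr0 ?subr0 //=.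
by case: eqP => _; rewrite ?IH ?addr0 ?subr0 ?addrK.
Qed.

Lemma div_genK i : cancel (div_gen i) (mul_gen i).
Proof.
move=> s; apply/funext; case=> [|j m] /=; rewrite /mul_gen /= ?addr0 ?subr0 //=.
by case: eqP => _; rewrite ?addr0 ?subr0 ?subrK.
Qed.

Definition cancelling l l' := (l.1 == l'.1) && (l.2 != l'.2).

Lemma letter_mulK l l' s : cancelling l l' -> letter_mul l (letter_mul l' s) = s.
Proof.
case: l l' => i b [j c] /andP[/= /eqP<-]; rewrite /letter_mul /=.
by case: b c => [] [] // _; rewrite ?mul_genK ?div_genK.
Qed.

Lemma letter_mulD l s t m :
  letter_mul l (fun m => s m + t m) m = letter_mul l s m + letter_mul l t m.
Proof.
case: l => i [] /=; rewrite /letter_mul /=.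
  elim: m => [|j m IH] /=; first by rewrite !subr0.
  by case: eqP => _; rewrite ?IH; ring.
by rewrite /mul_gen; case: m => [|j m]; [|case: eqP => _]; ring.
Qed.

Lemma word_mulD w s t m :
  word_mul w (fun m => s m + t m) m = word_mul w s m + word_mul w t m.
Proof.
elim: w m => //= l w IH m.
rewrite -letter_mulD; congr (letter_mul l _ m).
by apply/funext => m'; exact: IH.
Qed.

(** Multiplying by a series with constant term 1 preserves the lowest-degree part
    of [s]. *)
Lemma word_mul_lowest d w s :
  (forall m, (size m < d)%N -> s m = 0) ->
  forall m, (size m <= d)%N -> word_mul w s m = s m.
Proof.
move=> s0; elim: w => //= l w IH.
have {}s0 m : (size m < d)%N -> word_mul w s m = 0.
  by move=> lt_md; rewrite IH ?s0 // ltnW.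
move: (word_mul w s) IH s0 => t st t0 m le_md; rewrite -st //; case: l => i [].
  rewrite /letter_mul /=; elim: m le_md => [|j m IHm] /= le_md.
    by rewrite subr0.
  case: eqP => _; last by rewrite subr0.
  by rewrite IHm ?(ltnW le_md) // (t0 m) // subr0.
rewrite /letter_mul /mul_gen /=; case: m le_md => [|j m] /= le_md.
  by rewrite addr0.
by case: eqP => _; rewrite ?(t0 m) ?addr0.
Qed.

Definition alternating m := sorted (fun i j => i != j) m.

Lemma letter_mul_alternating l s m : alternating m ->
  letter_mul l s m =
  s m + (if m is j :: m' then if j == l.1 then (-1) ^+ l.2 * s m' else 0 else 0).
Proof.
case: l => i [] /=; rewrite /letter_mul /=; last first.
  by case: m => [|j m] _ //=; rewrite /mul_gen ?expr0 ?mul1r.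
case: m => [|j m] /=; first by rewrite ?subr0 ?addr0.
case: eqP => [->|_]; last by rewrite ?subr0 ?addr0.
rewrite expr1 mulN1r; case: m => [|p m] /=; first by rewrite subr0.
by move=> /andP[]; rewrite eq_sym => /negPf-> _; rewrite subr0.
Qed.

(** If [g] is a product of syllables [x_i ^ e_i] with adjacent indices distinct,
    then the coefficient of [x_i1 x_i2 .. x_ik] in its expansion is the product of
    the exponents, and longer alternating monomials have coefficient zero.  Here
    [l] is the first letter of the word, [k] lists the indices of the syllables
    after the first one, [s k] is the product of their exponents, and [e] is the
    absolute value of the exponent of the first syllable. *)
Definition leading l s : Prop := exists k,
  [/\ alternating (l.1 :: k), s k != 0,
      exists2 e : int, 0 < e & s (l.1 :: k) = (-1) ^+ l.2 * e * s k &
      forall m, alternating m -> (size k < size m)%N ->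
        (ohead m != Some l.1) || ((size k).+1 < size m)%N -> s m = 0].

Lemma leading_word l w : reduced (l :: w) -> leading l (word_mul (l :: w) series1).
Proof.
elim: w l => [|l' w IH] [i b] /=.
  move=> _; exists [::]; split=> //.
  - by rewrite letter_mul_alternating.
  - exists 1 => //; rewrite !letter_mul_alternating //= eqxx /series1 /=.
    by rewrite addr0 !mulr1 add0r.
  case=> [|j m] //= Am _; rewrite letter_mul_alternating //= /series1 /= add0r.
  rewrite (inj_eq Some_inj) => /orP[/negPf->//|].
  by rewrite ltnS; case: eqP => // _; case: m {Am} => //= *; rewrite mulr0.
rewrite /reduced /= => /andP[nc red]; have {IH} := IH _ red.
case: l' nc red => j c /= nc _.
move: (letter_mul _ _) => s [k [/= Ak sk0 [e e_gt0 sjk] s0]].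
have [eij|nij] := eqVneq i j.
  rewrite -{j}eij in nc Ak sjk s0 *.
  rewrite eqxx /= negbK in nc; rewrite -(eqP nc) in sjk.
  have Ak' : alternating k by apply: path_sorted Ak.
  have sk : letter_mul (i, b) s k = s k.
    rewrite letter_mul_alternating //=; case: (k) Ak => [|p k'] /=.
      by rewrite addr0.
    by rewrite eq_sym => /andP[/negPf-> _]; rewrite addr0.
  exists k; split=> //=; rewrite ?sk //.
    exists (e + 1); first by rewrite addr_gt0.
    by rewrite letter_mul_alternating //= eqxx sjk; ring.
  move=> m Am lt_km h; rewrite letter_mul_alternating // s0 // add0r.
  case: m Am lt_km h => [|p m] //= Am lt_km.
  rewrite (inj_eq Some_inj); case: eqP => //= epi; rewrite epi in Am => lt_km'.
  rewrite s0 ?mulr0 //; first exact: path_sorted Am.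
  by case: m Am {lt_km lt_km'} => //= q m /andP[]; rewrite (inj_eq Some_inj) eq_sym => ->.
have sk : letter_mul (i, b) s (j :: k) = s (j :: k).
  by rewrite letter_mul_alternating //= eq_sym (negPf nij) addr0.
have sk1 : s (j :: k) != 0 by rewrite sjk !mulf_neq0 ?signr_eq0 // gt_eqF.
exists (j :: k); split=> //=; rewrite ?sk ?nij //.
  exists 1 => //; rewrite letter_mul_alternating /= ?nij // eqxx s0 /=; first by ring.
  - by rewrite nij.
  - by rewrite ltnW.
  - by rewrite ltnS leqnn orbT.
move=> m Am lt_km h; rewrite letter_mul_alternating // s0 ?add0r //; last first.
- by rewrite lt_km orbT.
- by rewrite ltnW.
case: m Am lt_km h => [|p m] //= Am lt_km; rewrite (inj_eq Some_inj).
case: eqP => //= _; rewrite ltnS => lt_km'.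
by rewrite s0 ?mulr0 ?lt_km' ?orbT ?(ltnW lt_km') //; exact: path_sorted Am.
Qed.

Lemma word_mul_neq1 w : reduced w -> w != [::] ->
  exists2 m, m != [::] & word_mul w series1 m != 0.
Proof.
case: w => // l w /leading_word[k [_ k0 [e e0 E] _]] _.
by exists (l.1 :: k); rewrite // E !mulf_neq0 ?signr_eq0 // gt_eqF.
Qed.

Definition cons_reduced l w :=
  if w is l' :: w' then if cancelling l l' then w' else l :: w else [:: l].

Definition reduce w := foldr cons_reduced [::] w.

Lemma reduced_reduce w : reduced (reduce w).
Proof.
elim: w => //= l w; case: (reduce w) => [|l' w'] //= red.
case: ifP => [_|nc]; first exact: path_sorted red.
by rewrite /reduced /= red andbT -/(cancelling l l') nc.
Qed.

Lemma word_mul_reduce w s : word_mul (reduce w) s = word_mul w s.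
Proof.
elim: w => //= l w <-; case: (reduce w) => [|l' w'] //=.
by case: ifP => // /letter_mulK->.
Qed.

Section FreeGroup.
Variables (G : groupType) (X : 'I_n -> G).
Hypothesis X_free : free_basis X.

Lemma letter_valK l l' : cancelling l l' -> (letter_val X l * letter_val X l' = 1)%g.
Proof.
case: l l' => i b [j c] /andP[/= /eqP<-]; rewrite /letter_val /=.
by case: b c => [] [] // _; rewrite ?mulgV ?mulVg.
Qed.

Lemma word_val_cons l w : word_val X (l :: w) = (letter_val X l * word_val X w)%g.
Proof. by rewrite /word_val big_cons. Qed.

Lemma word_val_reduce w : word_val X (reduce w) = word_val X w.
Proof.
elim: w => //= l w IH; rewrite [RHS]word_val_cons -IH.
case: (reduce w) => [|l' w'] //=; first by rewrite word_val_cons.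
case: ifP => // ll'; last by rewrite word_val_cons.
by rewrite word_val_cons mulgA letter_valK // mul1g.
Qed.

Lemma reduced_inj w w' :
  reduced w -> reduced w' -> word_val X w = word_val X w' -> w = w'.
Proof.
move=> rw rw' e; have [v [_ v_uniq]] := X_free (word_val X w).
by rewrite -(v_uniq w) // (v_uniq w').
Qed.

Definition word_of (g : G) : seq ('I_n * bool) := projT1 (cid (X_free g)).

Lemma word_ofP g : reduced (word_of g) /\ word_val X (word_of g) = g.
Proof. by rewrite /word_of; case: cid => w []. Qed.

Definition magnus (g : G) : seq 'I_n -> int := word_mul (word_of g) series1.

Lemma magnusM g h m : magnus (g * h)%g m = word_mul (word_of g) (magnus h) m.
Proof.
have -> : word_mul (word_of g) (magnus h) = word_mul (word_of g ++ word_of h) series1.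
  by rewrite /word_mul foldr_cat.
rewrite /magnus -[in RHS]word_mul_reduce.
have [_ eg] := word_ofP g; have [_ eh] := word_ofP h.
have [rgh egh] := word_ofP (g * h)%g.
congr (word_mul _ _ _); apply: reduced_inj rgh (reduced_reduce _) _.
by rewrite egh word_val_reduce -[in LHS]eg -[in LHS]eh /word_val big_cat.
Qed.

(** Modulo terms of degree greater than [d], a product of two series of the form
    [1 + (degree at least d)] is computed by adding the degree [d] parts. *)
Lemma magnus_lowest d g h :
  (forall m, m != [::] -> (size m < d)%N -> magnus h m = 0) ->
  forall m, m != [::] -> (size m <= d)%N -> magnus (g * h)%g m = magnus g m + magnus h m.
Proof.
move=> h0 m m0 le_md.
pose t k := magnus h k - series1 k.
have ht : magnus h = (fun k => series1 k + t k).
  by apply/funext => k; rewrite /t addrC subrK.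
rewrite magnusM {1}ht word_mulD -/(magnus g) (@word_mul_lowest d) //.
  by rewrite /t /series1 (negPf m0) subr0.
move=> k lt_kd; have [->|k0] := eqVneq k [::]; last first.
  by rewrite /t h0 // /series1 (negPf k0) subr0.
rewrite /t /series1 /= /magnus.
suff -> : word_mul (word_of h) series1 [::] = 1 by rewrite subrr.
by rewrite (@word_mul_lowest 0).
Qed.

Lemma magnus_neq1 g : g <> 1%g -> exists2 m, m != [::] & magnus g m != 0.
Proof.
move=> g1; have [rg eg] := word_ofP g; apply: word_mul_neq1 => //.
by apply/eqP => w0; apply: g1; rewrite -eg w0 /word_val big_nil.
Qed.

End FreeGroup.
End Magnus.

Section Indicability.
Variable G : groupType.

(** The image of a nonzero homomorphism to the integers is infinite cyclic. *)
Lemma surjective_hom_int (psi : G -> int) :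
  {morph psi : x y / (x * y)%g >-> x + y} -> (exists x, psi x != 0) ->
  exists phi : {multiplicative G -> Algebra.to_multiplicative int},
    forall n : Algebra.to_multiplicative int, exists x, phi x = n.
Proof.
move=> psiM psi0.
have psi1 : psi 1%g = 0 by apply: (addrI (psi 1%g)); rewrite -psiM mulg1 addr0.
have psiV x : psi (x^-1)%g = - psi x.
  by apply/eqP; rewrite -addr_eq0 addrC -psiM mulgV psi1.
have psiX x n : psi (x ^+ n)%g = psi x *+ n.
  by elim: n => [|n IH]; rewrite ?expg0 ?psi1 // expgS psiM IH mulrS.
have psiXz x (q : int) : exists y, psi y = psi x * q.
  case: q => n; first by exists (x ^+ n)%g; rewrite psiX pmulrn mulrzz.
  by exists (x ^- n.+1)%g; rewrite psiV psiX NegzE pmulrn mulrzz mulrN.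
pose P d := `[< exists x, psi x = d.+1%:Z >].
have exP : exists d, P d.
  case: psi0 => x nx; case E: (psi x) nx => [[//|d]|d] nx.
    by exists d; apply/asboolP; exists x.
  by exists d; apply/asboolP; exists (x^-1)%g; rewrite psiV E NegzE opprK.
case: (ex_minnP exP) => d /asboolP[x0 psix0] dmin.
have dvd x : (d.+1 %| psi x)%Z.
  have [y psiy] := psiXz x0 (- (psi x %/ d.+1)%Z).
  have psixy : psi (x * y)%g = (psi x %% d.+1)%Z.
    by rewrite psiM psiy psix0 {1}(divz_eq (psi x) d.+1); lia.
  have := modz_ge0 (psi x) (isT : d.+1%:Z != 0).
  have := ltz_pmod (psi x) (isT : 0 < d.+1%:Z).
  case E : (psi x %% d.+1)%Z psixy => [[|e]|] //.
    by move=> _ _ _; apply/dvdz_mod0P.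
  move=> psixy lt_ed _; have := dmin e.
  have -> : P e by apply/asboolP; exists (x * y)%g.
  by move=> /(_ isT); lia.
pose phi (x : G) : Algebra.to_multiplicative int := (psi x %/ d.+1)%Z.
have phiM : {morph phi : x y / (x * y)%g}.
  by move=> x y; rewrite /phi psiM divzDl.
pose phi' : {multiplicative G -> Algebra.to_multiplicative int} :=
  HB.pack phi (isMultiplicative.Build _ _ phi phiM).
exists phi' => n; have [y psiy] := psiXz x0 n.
by exists y; rewrite /= /phi psiy psix0 mulKz.
Qed.

End Indicability.

Theorem locally_indicable_semidirect (F : groupClosed SL2Z) n :
  free_of_rank n (subgroup_of F) -> locally_indicable (semidirect F).
Proof.
move=> [X X_free] H _ [x0 x0H x01].
have [inZ2|] := pselect (forall x : subgroup_of H, (val x).2 = 1%g).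
  have M : {morph (fun x : subgroup_of H => (val x).1) : x y / (x * y)%g >-> x + y}.
    by move=> x y /=; rewrite inZ2 act1.
  have [i x0i] : exists i, x0.1 i 0 != 0.
    apply/existsP; apply: contra_notT x01 => /existsPn x00.
    apply: injective_projections => /=; last exact: (inZ2 (SubgroupOf x0H)).
    by apply/matrixP => i j; rewrite ord1 mxE; apply/eqP; rewrite -[_ == _]negbK x00.
  apply: (@surjective_hom_int (subgroup_of H) (fun x => (val x).1 i 0)).
    by move=> x y; rewrite M mxE.
  by exists (SubgroupOf x0H).
move=> /existsNP[x1 x11].
have [m1 m1N m1x] := magnus_neq1 X_free x11.
pose P d := `[< exists (x : subgroup_of H) m,
                [/\ m != [::], size m = d & magnus X_free (val x).2 m != 0] >].
have exP : exists d, P d.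
  by exists (size m1); apply/asboolP; exists x1, m1.
case: (ex_minnP exP) => d /asboolP[x [m [mN md mx]]] dmin.
apply: (@surjective_hom_int (subgroup_of H) (fun y => magnus X_free (val y).2 m));
  last by exists x.
move=> y z /=; apply: (@magnus_lowest _ _ _ X_free d); rewrite ?md // => k kN lt_kd.
apply/eqP/negPn/negP => kz; suff: (d <= size k)%N by rewrite leqNgt lt_kd.
by apply: dmin; apply/asboolP; exists z, k.
Qed.

(** * Increasing bijections and fixed points *)

Section Diff1Order.
Variable R : realType.
Implicit Types (f g : diff1 R) (x y : R).

Lemma diff1M f g x : (f * g)%g x = f (g x). Proof. by []. Qed.

Lemma diff1K f : cancel f (f^-1)%g.
Proof. by move=> x; rewrite -diff1M mulVg. Qed.

Lemma diff1VK f : cancel (f^-1)%g f.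
Proof. by move=> x; rewrite -diff1M mulgV. Qed.

Lemma diff1_out f x : x \notin `]0, 1[ -> f x = x.
Proof. by case: (diff1P f) => -[_ h] _ _ _; exact: h. Qed.

Lemma diff1_in f x : 0 < x < 1 -> 0 < f x < 1.
Proof. by case: (diff1P f) => -[h _] _ _ _; have := h x; rewrite !in_itv. Qed.

Lemma diff1_le f : {mono f : x y / x <= y}.
Proof.
apply: le_mono => x y xy.
have [xI|xO] := boolP (x \in `]0, 1[); have [yI|yO] := boolP (y \in `]0, 1[).
- by case: (diff1P f) => _ _ h _; exact: h.
- rewrite (diff1_out f yO); move: xI yO; rewrite !in_itv /= => xI.
  by have := diff1_in f xI; lra.
- rewrite (diff1_out f xO); move: yI xO; rewrite !in_itv /= => yI.
  by have := diff1_in f yI; lra.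
- by rewrite !diff1_out.
Qed.

Lemma diff1_lt f : {mono f : x y / x < y}.
Proof. exact: leW_mono (diff1_le f). Qed.

Lemma diff1_sup f (S : set R) : has_sup S -> sup (f @` S)%classic = f (sup S).
Proof.
move=> hS; have [[a Sa] [b Sb]] := hS.
have fS0 : (f @` S !=set0)%classic by exists (f a), a.
apply/eqP; rewrite eq_le; apply/andP; split.
  apply: ge_sup => // _ [x Sx <-]; rewrite diff1_le.
  by apply: ub_le_sup Sx; case: hS.
rewrite -[X in _ <= X](diff1VK f) diff1_le.
apply: ge_sup; first by exists a.
move=> x Sx; rewrite -(diff1_le f) diff1VK; apply: ub_le_sup; last by exists x.
by exists (f b) => _ [y Sy <-]; rewrite diff1_le; exact: Sb.
Qed.

Lemma diff1_inf f (S : set R) : has_inf S -> inf (f @` S)%classic = f (inf S).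
Proof.
move=> hS; have [[a Sa] [b Sb]] := hS.
have fS0 : (f @` S !=set0)%classic by exists (f a), a.
apply/eqP; rewrite eq_le; apply/andP; split.
  rewrite -[X in X <= _](diff1VK f) diff1_le.
  apply: lb_le_inf; first by exists a.
  move=> x Sx; rewrite -(diff1_le f) diff1VK; apply: ge_inf; last by exists x.
  by exists (f b) => _ [y Sy <-]; rewrite diff1_le; exact: Sb.
apply: lb_le_inf => // _ [x Sx <-]; rewrite diff1_le.
by apply: ge_inf Sx; case: hS.
Qed.

(** The supremum of the points between [x] and [y] that [f] does not move down is
    fixed. *)
Lemma fixed_between f x y :
  x <= y -> x <= f x -> f y <= y -> exists2 z, x <= z <= y & f z = z.
Proof.
move=> xy xf fy; pose S := [set w | [/\ x <= w, w <= y & w <= f w]]%classic.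
have Sx : S x by [].
have Sub : has_ubound S by exists y => w [].
have xz : x <= sup S by exact: ub_le_sup.
have zy : sup S <= y by apply: ge_sup; [exists x | move=> w []].
have zf : sup S <= f (sup S).
  apply: ge_sup; first by exists x.
  move=> w Sw; have [_ _ wf] := Sw; apply: le_trans wf _.
  by rewrite diff1_le; exact: ub_le_sup.
exists (sup S); first by rewrite xz.
apply/eqP; rewrite eq_le zf andbT; apply: ub_le_sup => //; split.
- exact: le_trans zf.
- by apply: le_trans fy; rewrite diff1_le.
- by rewrite diff1_le.
Qed.

Lemma fixed_between' f x y :
  x <= y -> f x <= x -> y <= f y -> exists2 z, x <= z <= y & f z = z.
Proof.
move=> xy fx yf; have [||z xzy fz] := @fixed_between (f^-1)%g x y xy.
- by rewrite -(diff1_le f) diff1VK.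
- by rewrite -(diff1_le f) diff1VK.
- by exists z => //; rewrite -{1}fz diff1VK.
Qed.

Lemma displacement_sign f x y :
  (forall z, 0 < z < 1 -> f z <> z) -> 0 < x < 1 -> 0 < y < 1 ->
  x < f x -> y < f y.
Proof.
move=> nf xI yI xf; rewrite ltNge; apply/negP => fy.
have [xy|yx] := leP x y.
  have [z zI fz] := fixed_between xy (ltW xf) fy.
  by apply: (nf z) => //; lra.
have [z zI fz] := fixed_between' (ltW yx) fy (ltW xf).
by apply: (nf z) => //; lra.
Qed.

(** If neither [f * g] nor [f * g^-1] had a fixed point, each would move all points
    in one direction: the same one at a fixed point of [g], opposite ones at a
    fixed point of [f]. *)
Lemma fixed_mul_or_div f g x y : 0 < x < 1 -> 0 < y < 1 -> f x = x -> g y = y ->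
  exists2 z, 0 < z < 1 & (f * g)%g z = z \/ (f * g^-1)%g z = z.
Proof.
move=> xI yI fx gy; apply: contrapT => h.
have h1 z : 0 < z < 1 -> (f * g)%g z <> z by move=> zI e; apply: h; exists z; [|left].
have h2 z : 0 < z < 1 -> (f * g^-1)%g z <> z by move=> zI e; apply: h; exists z; [|right].
have gVy : (g^-1)%g y = y by rewrite -{1}gy diff1K.
have gx : g x <> x by move=> gx; apply: (h1 x) => //; rewrite diff1M gx.
have fy : f y <> y by move=> fy; apply: (h1 y) => //; rewrite diff1M gy.
have S1 := displacement_sign h1; have S2 := displacement_sign h2.
have fVx : (f^-1)%g x = x by rewrite -{1}fx diff1K.
have f1 : (x < (f * g)%g x) = (x < g x) by rewrite -{1}fx diff1M diff1_lt.
have f2 : (x < (f * g^-1)%g x) = (g x < x).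
  by rewrite -{1}fx diff1M diff1_lt -(diff1_lt g) diff1VK.
have f3 : (y < (f * g)%g y) = (y < f y) by rewrite diff1M gy.
have f4 : (y < (f * g^-1)%g y) = (y < f y) by rewrite diff1M gVy.
have : (y < f y) = (x < g x).
  by rewrite -f1 -f3; apply/idP/idP; [exact: S1 | exact: S1].
have : (y < f y) = (g x < x).
  by rewrite -f2 -f4; apply/idP/idP; [exact: S2 | exact: S2].
by move=> -> ; case: ltgtP gx => // ->.
Qed.

End Diff1Order.

Section Iterates.
Variable R : realType.
Implicit Types (s : diff1 R) (l r q p d : R).

Lemma expg_fixed s q k : s q = q -> (s ^+ k)%g q = q.
Proof. by move=> sq; elim: k => // k IH; rewrite expgS diff1M IH. Qed.

Lemma iterates_increase s x : x <= s x ->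
  {homo (fun k => (s ^+ k)%g x) : m n / (m <= n)%N >-> m <= n}.
Proof.
move=> xs; apply: homo_leq => [y|y z w|k]; [exact: lexx|exact: le_trans|].
by rewrite expgSr diff1M diff1_le.
Qed.

Lemma iterates_decrease s x : s x <= x ->
  {homo (fun k => (s ^+ k)%g x) : m n / (m <= n)%N >-> n <= m}.
Proof.
move=> xs; apply: (homo_leq (r := fun y z => z <= y)) => [y|y z w zy yw|k].
- exact: lexx.
- exact: le_trans yw zy.
by rewrite expgSr diff1M diff1_le.
Qed.

Lemma iterates_to_fixed_up s l r q :
  l < r -> r <= s l -> r <= q -> s q = q -> 0 < r -> q < 1 ->
  exists2 p, 0 < p < 1 & forall d, 0 < d -> exists K, forall k, (K <= k)%N ->
    p - d < (s ^+ k)%g l /\ (s ^+ k)%g r < p + d.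
Proof.
move=> lr rs rq sq r0 q1; pose S := range (fun k => (s ^+ k)%g l).
have Sq : ubound S q.
  by move=> _ [k _ <-]; rewrite -(expg_fixed k sq) diff1_le (le_trans _ rq) ?ltW.
have S0 : (S !=set0)%classic by exists ((s ^+ 0)%g l), 0%N.
have Sub : has_ubound S by exists q.
have Sp k : (s ^+ k)%g l <= sup S by apply: (ub_le_sup Sub); exists k.
exists (sup S).
  have := Sp 1%N; rewrite expg1 => H; have := ge_sup S0 Sq; lra.
move=> d d0; have [_ [K _ <-] HK] : exists2 z, S z & sup S - d < z.
  by have [z] := sup_gt S0 (ltac:(lra) : sup S - d < sup S); exists z.
exists K => k Kk; split.
  apply: lt_le_trans HK _; apply: iterates_increase Kk.
  by rewrite (le_trans _ rs) ?ltW.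
apply: (@le_lt_trans _ _ ((s ^+ k.+1)%g l)); last by have := Sp k.+1; lra.
by rewrite expgSr diff1M diff1_le.
Qed.

Lemma iterates_to_fixed_down s l r q :
  l < r -> s r <= l -> q <= l -> s q = q -> 0 < q -> l < 1 ->
  exists2 p, 0 < p < 1 & forall d, 0 < d -> exists K, forall k, (K <= k)%N ->
    p - d < (s ^+ k)%g l /\ (s ^+ k)%g r < p + d.
Proof.
move=> lr rs ql sq q0 l1; pose S := range (fun k => (s ^+ k)%g r).
have Sq : lbound S q.
  by move=> _ [k _ <-]; rewrite -(expg_fixed k sq) diff1_le (le_trans ql) ?ltW.
have S0 : (S !=set0)%classic by exists ((s ^+ 0)%g r), 0%N.
have Slb : has_lbound S by exists q.
have Sp k : inf S <= (s ^+ k)%g r by apply: (ge_inf Slb); exists k.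
exists (inf S).
  have := Sp 1%N; rewrite expg1 => H; have := lb_le_inf S0 Sq; lra.
move=> d d0; have [_ [K _ <-] HK] : exists2 z, S z & z < inf S + d.
  by have [z] := inf_lt S0 (ltac:(lra) : inf S < inf S + d); exists z.
exists K => k Kk; split.
  apply: (@lt_le_trans _ _ ((s ^+ k.+1)%g r)); first by have := Sp k.+1; lra.
  by rewrite expgSr diff1M diff1_le.
apply: le_lt_trans HK; apply: iterates_decrease Kk.
by rewrite (le_trans rs) ?ltW.
Qed.

Lemma diff1_torsion_free s n : (s ^+ n.+1 = 1)%g -> s = 1%g.
Proof.
move=> sn; apply/val_inj/funext => x /=.
have E : (s ^+ n.+1)%g x = x by rewrite sn.
apply/eqP; rewrite eq_le; apply/andP; split; rewrite leNgt; apply/negP => lt.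
  have := iterates_increase (ltW lt) (isT : (1 <= n.+1)%N).
  by rewrite E expg1 leNgt lt.
have := iterates_decrease (ltW lt) (isT : (1 <= n.+1)%N).
by rewrite E expg1 leNgt lt.
Qed.

End Iterates.

(** * Free actions of groups on the interval *)

Section Hoelder.
Variables (R : realType) (G : groupType) (rho : G -> diff1 R).
Hypothesis rhoM : {morph rho : g h / (g * h)%g}.
Hypothesis rho_free : forall g x, 0 < x < 1 -> rho g x = x -> g = 1%g.
Implicit Types (g h k : G) (x z : R).

Let x0 : R := 2^-1.
Let x0I : 0 < x0 < 1. Proof. by rewrite /x0; lra. Qed.
Let v g : R := rho g x0.

Let rho1 : rho 1%g = 1%g.
Proof. by apply: (mulgI (rho 1%g)); rewrite -rhoM !mulg1. Qed.

Let rhoV g : rho (g^-1)%g = ((rho g)^-1)%g.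
Proof. by apply: (mulgI (rho g)); rewrite -rhoM !mulgV rho1. Qed.

Let vI g : 0 < v g < 1. Proof. exact: diff1_in. Qed.

Let v_mull k g h : (v (k * g)%g < v (k * h)%g) = (v g < v h).
Proof. by rewrite /v !rhoM !diff1M diff1_lt. Qed.

Let v_inj : injective v.
Proof.
move=> g h e; apply/esym; apply: (mulgI (g^-1)%g); rewrite mulVg.
by apply: (rho_free x0I); rewrite rhoM diff1M rhoV -/(v h) -e diff1K.
Qed.

Let v_lt g h x : v g < v h -> 0 < x < 1 -> rho g x < rho h x.
Proof.
move=> gh xI; have [e|ne] := eqVneq h g; first by rewrite e ltxx in gh.
have : x < rho (g^-1 * h)%g x.
  apply: (displacement_sign _ x0I xI).
    move=> z zI /(rho_free zI) e; case/eqP: ne.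
    by apply: (mulgI (g^-1)%g); rewrite e mulVg.
  by rewrite rhoM rhoV diff1M -(diff1_lt (rho g)) diff1VK.
by rewrite rhoM rhoV diff1M -(diff1_lt (rho g)) diff1VK.
Qed.

Let v_mulr k g h : v g < v h -> v (g * k)%g < v (h * k)%g.
Proof. by move=> gh; rewrite /v !rhoM !diff1M; apply: v_lt (vI k). Qed.

Let v_mulr_le k g h : v g <= v h -> v (g * k)%g <= v (h * k)%g.
Proof. by rewrite le_eqVlt => /orP[/eqP/v_inj->//|/(v_mulr k)/ltW]. Qed.

Let v_mull_le k g h : (v (k * g)%g <= v (k * h)%g) = (v g <= v h).
Proof. by rewrite !leNgt v_mull. Qed.

Let v_lt_inv g h : v g < v h -> v (h^-1)%g < v (g^-1)%g.
Proof. by move=> gh; rewrite -(v_mull h) mulgV -[X in v X < _](mulgV g); exact: v_mulr. Qed.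

Let archimedean k g : v 1%g < v k -> exists n, v g < v (k ^+ n)%g.
Proof.
move=> k1; apply: contrapT => /forallNP gk.
pose S := range (fun n => v (k ^+ n)%g).
have Sub : has_ubound S by exists (v g) => _ [n _ <-]; rewrite leNgt; exact/negP.
have Sn n : S (v (k ^+ n)%g) by exists n.
have zI : 0 < sup S < 1.
  apply/andP; split.
    by apply: lt_le_trans (ub_le_sup Sub (Sn 0%N)); have := vI (k ^+ 0)%g; lra.
  apply: le_lt_trans (_ : v g < 1); last by have := vI g; lra.
  apply: ge_sup; first by exists (v (k ^+ 0)%g).
  by move=> _ [n _ <-]; rewrite leNgt; exact/negP.
have : sup S < rho k (sup S).
  by have := v_lt k1 zI; rewrite rho1.
rewrite -[X in X < _](diff1VK (rho k)) diff1_lt ltNge => /negP; apply.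
apply: ge_sup; first by exists (v (k ^+ 0)%g).
move=> _ [n _ <-]; rewrite -(diff1_le (rho k)) diff1VK.
have -> : rho k (v (k ^+ n)%g) = v (k ^+ n.+1)%g by rewrite /v expgS rhoM.
by apply: (ub_le_sup Sub); exact: Sn.
Qed.

(** Rounding [g] down to a power of [k]; that power is given by its numerator and
    denominator so as to allow negative exponents. *)
Let floor k g : v 1%g < v k ->
  exists N m, v (k ^- N * k ^+ m)%g <= v g /\ v g < v (k ^- N * k ^+ m * k)%g.
Proof.
move=> k1; have [N gN] := archimedean (g^-1)%g k1.
have [M gM] := archimedean (k ^+ N * g)%g k1.
have exP : exists m, v g < v (k ^- N * k ^+ m)%g.
  by exists M; rewrite -(v_mull (k ^+ N)%g) mulVKg.
case: (ex_minnP exP) => -[|m] gm mmin.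
  have := v_lt_inv gN; rewrite invgK => gN'.
  by move: gm; rewrite expg0 mulg1 ltNge (ltW gN').
exists N, m; rewrite -mulgA -expgSr; split=> //; rewrite leNgt; apply/negP => /mmin.
by rewrite ltnn.
Qed.

Let powers_commute k N m N' m' :
  commute (k ^- N * k ^+ m)%g (k ^- N' * k ^+ m')%g.
Proof.
have cV M y : commute y k -> commute y (k ^- M)%g.
  by move=> yk; apply/commuteV/commuteX.
have ck : commute (k ^- N * k ^+ m)%g k.
  apply/commute_sym/commuteM; first exact: cV.
  exact: commuteX.
by apply: commuteM; [exact: cV | exact: commuteX].
Qed.

(** The commutator [c] of [f] and [g] would exceed 1.  If no element lies strictly
    between 1 and [c], then all elements are powers of [c].  Otherwise there is a [k]
    above 1 with [k ^ 2 <= c], and rounding [f] and [g] down to the powers [p] and [q]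
    of [k] gives [f g < p q k ^ 2 <= c g f = f g]. *)
Let hoelder_wlog f g : ~ v (g * f)%g < v (f * g)%g.
Proof.
move=> lt_gf; pose c := (f * g * (g * f)^-1)%g.
have c1 : v 1%g < v c by rewrite -(mulgV (g * f)%g); exact: v_mulr.
have [[k [k1 kc]]|nk] := pselect (exists k, v 1%g < v k /\ v k < v c); last first.
  have pow h : exists N m, h = (c ^- N * c ^+ m)%g.
    have [N [m [le_h lt_h]]] := floor h c1; exists N, m.
    apply: v_inj; apply/eqP; rewrite eq_le le_h andbT leNgt; apply/negP => lt_h'.
    apply: nk; exists ((c ^- N * c ^+ m)^-1 * h)%g.
    by split; rewrite -(v_mull (c ^- N * c ^+ m)%g) ?mulg1 mulVKg.
  have [N [m ef]] := pow f; have [N' [m' eg]] := pow g.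
  by move: lt_gf; rewrite ef eg powers_commute ltxx.
have [{}k {}k1 {kc}kc] : exists2 k, v 1%g < v k & v (k * k)%g <= v c.
  have [|lt_c] := leP (v (k * k)%g) (v c); first by exists k.
  exists (c * k^-1)%g; first by rewrite -(mulgV k); exact: v_mulr.
  rewrite -[X in _ <= v X](mulgVK k) v_mull_le -[X in _ <= v X](mulgK k).
  exact/v_mulr_le/ltW.
have [N [m [le_f lt_f]]] := floor f k1; have [N' [m' [le_g lt_g]]] := floor g k1.
set p := (k ^- N * k ^+ m)%g in le_f lt_f; set q := (k ^- N' * k ^+ m')%g in le_g lt_g.
have pq : commute p q by exact: powers_commute.
have kq : commute k q.
  by have := powers_commute k 0 1 N' m'; rewrite expg0 invg1 mul1g expg1.
have kp : commute k p.
  by have := powers_commute k 0 1 N m; rewrite expg0 invg1 mul1g expg1.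
clearbody p q; have : v (f * g)%g < v (p * q * (k * k))%g.
  apply: lt_trans (v_mulr g lt_f) _; rewrite -!mulgA v_mull.
  by rewrite [(q * _)%g]mulgA -kq -!mulgA v_mull.
rewrite ltNge => /negP; apply.
have -> : (f * g = c * (g * f))%g by rewrite mulgVK.
apply: (le_trans _ (v_mulr_le (g * f)%g kc)).
have -> : (p * q * (k * k) = k * k * (q * p))%g.
  rewrite -pq; apply/commute_sym/commuteM; apply/commute_sym; apply: commuteM;
  exact: commute_sym.
rewrite v_mull_le; apply: le_trans (v_mulr_le f le_g); by rewrite v_mull_le.
Qed.

(** Hoelder's theorem: comparing elements by their effect on a point makes [G] an
    Archimedean bi-ordered group. *)
Theorem free_action_abelian f g : commute f g.
Proof.
apply: v_inj; apply/eqP; rewrite eq_le !leNgt.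
by apply/andP; split; apply/negP; exact: hoelder_wlog.
Qed.

End Hoelder.

(** * Control of distortion near a fixed point *)

Section Distortion.
Variable R : realType.
Implicit Types (f : diff1 R) (p x y e d : R).

(** The mean value theorem, and the continuity of the derivative at [p]. *)
Lemma diff1_distortion f p e : 0 < p < 1 -> 0 < e ->
  exists2 d, 0 < d & forall x y, p - d < x -> x <= y -> y < p + d ->
    (derive1 f p - e) * (y - x) <= f y - f x <= (derive1 f p + e) * (y - x).
Proof.
move=> pI e0; have [_ fC _ _] := diff1P f.
have [_ fc] := fC p (ltac:(by rewrite in_itv)).
have /nbhs_ballP[d1 /= d1_gt0 close] :
    (\forall x \near p, `|derive1 f p - derive1 f x| < e)%classic.
  have {}fc : (derive1 f x @[x --> p] --> derive1 f p)%classic by exact: fc.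
  by move/cvgrPdist_lt : fc => /(_ _ e0).
pose d := Num.min d1 (Num.min p (1 - p)).
have d0 : 0 < d by rewrite !lt_min d1_gt0 /=; lra.
have dd1 : d <= d1 by rewrite ge_min lexx.
have dp : d <= p by rewrite !ge_min lexx orbT.
have dp1 : d <= 1 - p by rewrite !ge_min lexx !orbT.
exists d => // x y dx; rewrite le_eqVlt => /predU1P[<-|xy] yd.
  by rewrite !subrr !mulr0 lexx.
have zI z : x <= z <= y -> derivable f z 1.
  by move=> zI; have [] := fC z; rewrite ?in_itv //=; lra.
have [||c cI ->] := @MVT R f (derive1 f) x y xy.
- move=> z; rewrite in_itv /= => zxy; apply: DeriveDef; first by apply: zI; lra.
  by rewrite derive1E.
- by apply: derivable_within_continuous => z; rewrite in_itv /=; exact: zI.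
rewrite in_itv /= in cI.
have : `|derive1 f p - derive1 f c| < e.
  by apply: close; rewrite /ball /= ltr_norml; lra.
rewrite ltr_norml => h; rewrite !ler_pM2r ?subr_gt0 //; lra.
Qed.

Lemma diff1_derive_gt0 f p : 0 < p < 1 -> 0 < derive1 f p.
Proof.
move=> pI; have p01 : p \in `]0, 1[ by rewrite in_itv.
rewrite lt_neqAle; apply/andP; split.
  have [_ fC _ _] := diff1P f; have [_ gC _ _] := diff1P (f^-1)%g.
  have fd := (fC p p01).1.
  have gd : derivable (f^-1)%g (f p) 1.
    by have [] := gC (f p); rewrite ?in_itv //=; exact: diff1_in.
  have := derive1_comp fd gd.
  have -> : ((f^-1)%g \o f = id :> (R -> R))%FUN by apply/funext => x /=; rewrite diff1K.
  rewrite derive1_id => e1; apply/eqP => e2; move: e1; rewrite -e2 mulr0.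
  by move/eqP; rewrite oner_eq0.
rewrite leNgt; apply/negP => neg.
have [|d d0 H] := @diff1_distortion f p (- derive1 f p) pI; first by lra.
have /andP[_] := H p (p + d / 2) ltac:(lra) ltac:(lra) ltac:(lra).
by rewrite subrr mul0r subr_le0 diff1_le; lra.
Qed.

(** The integer parts of the quotients [(y i - a) / A] are distinct. *)
Lemma card_separated (I : finType) (y : I -> R) a A L : 0 < A -> 0 <= L ->
  (forall i, a <= y i /\ y i + A <= a + L) ->
  (forall i j, i != j -> y i + A <= y j \/ y j + A <= y i) ->
  #|I|%:R * A <= L.
Proof.
move=> A0 L0 yI sep; pose t i := Num.truncn ((y i - a) / A).
have tI i : (t i)%:R <= (y i - a) / A < (t i).+1%:R.
  by apply/truncn_itv/divr_ge0; [have := yI i; lra | exact: ltW].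
have t_lt i : (t i < Num.truncn (L / A))%N.
  rewrite truncn_gt_nat -natr1; have := tI i; rewrite !ler_pdivlMr ?ltr_pdivrMr //.
  by have := yI i; lra.
have t_inj : injective (fun i => Ordinal (t_lt i)).
  move=> i j /(congr1 val) /= tij; apply/eqP/negPn/negP => /sep.
  have := tI i; have := tI j; rewrite tij -!natr1 !ler_pdivlMr ?ltr_pdivrMr //; lra.
have := leq_card _ t_inj; rewrite card_ord -(ler_nat R) => le_card.
rewrite -ler_pdivlMr //; apply: le_trans le_card _.
by rewrite truncn_le divr_ge0 // ltW.
Qed.

(** Signed sums of a sequence that at least doubles at each step: the last term
    with a nonzero coefficient exceeds the sum of the preceding ones by at least
    the first term. *)
Lemma doubling_sum (a : nat -> R) (z : nat -> R) n :
  (forall i, 2 * `|a i| <= `|a i.+1|) ->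
  (forall i, [\/ z i = 0, z i = 1 | z i = -1]) ->
  `|\sum_(i < n) z i * a i| <= `|a n| - `|a 0%N| /\
  ((exists2 i, (i < n)%N & z i <> 0) -> `|a 0%N| <= `|\sum_(i < n) z i * a i|).
Proof.
move=> dbl z3; elim: n => [|n [IH1 IH2]].
  by rewrite big_ord0 normr0 subrr; split=> // -[].
rewrite big_ord_recr /=; set S := \sum_(i < n) _ in IH1 IH2 *.
have zn : `|z n * a n| <= `|a n|.
  by rewrite normrM; case: (z3 n) => ->; rewrite ?normrN ?normr0 ?normr1 ?mul1r ?mul0r.
have := dbl n; have := ler_normD S (z n * a n) => tri dn; split; first by lra.
move=> [i]; rewrite ltnS leq_eqVlt => /predU1P[->|lt_in] zi; last first.
  have [z0|] := eqVneq (z n) 0; first by rewrite z0 mul0r addr0; apply: IH2; exists i.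
  move=> z0; have : `|z n * a n| = `|a n|.
    by rewrite normrM; case: (z3 n) z0 => ->; rewrite ?eqxx ?normrN ?normr1 ?mul1r.
  by have := lerB_normD (z n * a n) S; rewrite [z n * a n + S]addrC; lra.
have : `|z n * a n| = `|a n|.
  by rewrite normrM; case: (z3 n) zi => ->; rewrite ?normrN ?normr1 ?mul1r.
by have := lerB_normD (z n * a n) S; rewrite [z n * a n + S]addrC; lra.
Qed.

Lemma bernoulli_half n : 1 + n%:R / 2 <= (3 / 2 : R) ^+ n.
Proof.
elim: n => [|n IH]; first by rewrite expr0; lra.
by rewrite exprS -natr1; have := ler0n R n; lra.
Qed.

End Distortion.

Section Mechanism.
Variables (R : realType) (V : zmodType) (T : V -> diff1 R) (s : diff1 R).
Variables (tau : V -> R) (l r p x0 x1 : R) (v1 v2 : V) (w W : nat -> V) (n0 : nat).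
Hypotheses
  (TD : forall u v, T (u + v) = (T u * T v)%g)
  (tauD : {morph tau : u v / u + v})
  (lr : l < r) (Tl : forall v, T v l = l) (Tr : forall v, T v r = r)
  (lx0 : l <= x0) (x01 : x0 < x1) (x1r : x1 <= r)
  (tau_sep : forall u v, tau u + 3 <= tau v -> T u x1 <= T v x0)
  (pI : 0 < p < 1)
  (s_cvg : forall d, 0 < d ->
     exists K, forall k, (K <= k)%N -> p - d < (s ^+ k)%g l /\ (s ^+ k)%g r < p + d)
  (w12 : forall n, w n = v1 \/ w n = v2)
  (sW : forall n, (T (w n) * s ^+ n = s ^+ n * T (W n))%g)
  (W_neq0 : forall n, tau (W n) <> 0)
  (W_double : forall n, (n0 <= n)%N -> 2 * `|tau (W n)| <= `|tau (W n.+1)|).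

Let m := derive1 s p.

(** This margin makes [2 * (m - e) * (1 - 2 * e)] at least [3 / 2 * (m + e)]. *)
Let e := Num.min (16^-1) (m / 16).

Let m_gt0 : 0 < m. Proof. exact: diff1_derive_gt0. Qed.
Let e_gt0 : 0 < e. Proof. by rewrite lt_min; apply/andP; split; have := m_gt0; lra. Qed.
Let e_le : e <= 16^-1. Proof. by rewrite ge_min lexx. Qed.
Let e_le_m : e <= m / 16. Proof. by rewrite ge_min lexx orbT. Qed.

Let tau0 : tau 0 = 0.
Proof. by apply: (addrI (tau 0)); rewrite -tauD !addr0. Qed.

Let T0 : T 0 = 1%g.
Proof. by apply: (mulgI (T 0)); rewrite -TD addr0 mulg1. Qed.

(** The exponential growth makes [tau (W n)] exceed the separation constant. *)
Let eventually_large :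
  exists K, (n0 <= K)%N /\ forall k, (K <= k)%N -> 3 <= `|tau (W k)|.
Proof.
have a0 : 0 < `|tau (W n0)| by rewrite normr_gt0; exact/eqP.
have H k : (1 + k%:R) * `|tau (W n0)| <= `|tau (W (n0 + k))|.
  elim: k => [|k IH]; first by rewrite addn0 addr0 mul1r.
  rewrite addnS; apply: le_trans (W_double (leq_addr _ _)).
  rewrite -natr1; have := ler0n R k; nra.
pose k := (Num.truncn (3 / `|tau (W n0)|)).+1.
exists (n0 + k)%N; split=> [|j /subnKC<-]; first exact: leq_addr.
rewrite -addnA; apply: le_trans (H _).
have := truncnS_gt (3 / `|tau (W n0)|); rewrite ltr_pdivrMr // -/k natrD.
by have := ler0n R (j - (n0 + k))%N; nra.
Qed.

(** Close to [p] the translations, which fix both [s ^+ k l] and [s ^+ k r], have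
    derivative close to 1, while [s] has nearly constant derivative. *)
Let eventually_affine : exists K, forall k, (K <= k)%N ->
  forall y z, (s ^+ k)%g l <= y -> y <= z -> z <= (s ^+ k)%g r ->
  (m - e) * (z - y) <= s z - s y <= (m + e) * (z - y) /\
  (1 - 2 * e) * (z - y) <= T (w k) z - T (w k) y.
Proof.
have [ds ds0 Hs] := diff1_distortion s pI e_gt0.
have [d1 d10 H1] := diff1_distortion (T v1) pI e_gt0.
have [d2 d20 H2] := diff1_distortion (T v2) pI e_gt0.
have d0 : 0 < Num.min ds (Num.min d1 d2) by rewrite !lt_min ds0 d10.
have [K HK] := s_cvg d0; exists K => k /HK.
set d := Num.min _ _; move=> [ld rd] y z ly yz zr.
have dds : d <= ds by rewrite ge_min lexx.
have dd1 : d <= d1 by rewrite !ge_min lexx orbT.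
have dd2 : d <= d2 by rewrite !ge_min lexx !orbT.
split; first by apply: Hs => //; lra.
have fixT x : T (W k) x = x -> T (w k) ((s ^+ k)%g x) = (s ^+ k)%g x.
  by move=> Tx; rewrite -diff1M sW diff1M Tx.
have lrk : (s ^+ k)%g l < (s ^+ k)%g r by rewrite diff1_lt.
suff [c Hc] : exists c, forall x x', p - d < x -> x <= x' -> x' < p + d ->
    (c - e) * (x' - x) <= T (w k) x' - T (w k) x <= (c + e) * (x' - x).
  have := Hc _ _ ld (ltW lrk) rd; rewrite !fixT // => /andP[_].
  rewrite -{1}[_ - _]mul1r ler_pM2r ?subr_gt0 // => c1.
  have /andP[+ _] := Hc y z ltac:(lra) yz ltac:(lra).
  by apply: le_trans; rewrite ler_wpM2r ?subr_ge0 //; lra.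
case: (w12 k) => ->; [exists (derive1 (T v1) p) | exists (derive1 (T v2) p)].
  by move=> x x' *; apply: H1 => //; lra.
by move=> x x' *; apply: H2 => //; lra.
Qed.

(** By [sW], applying [T (w k)] after [s ^+ k] amounts to applying [T (W k)] before
    it.  Each sequence [c] of [n] bits selects a product [P c n] of factors [s] and
    [s T (w k)], which equals [s ^+ (K + n)] preceded by the translation by [u c n].
    The vectors [u c n] are separated by [tau], so the images of the interval from
    [x0] to [x1] are disjoint.  There are [2 ^ n] of them and each has length at
    least [A ^+ n * E], while they lie in an interval of length at most
    [(m + e) ^+ n * D], and [2 * A] exceeds [m + e] by a definite factor. *)
Lemma no_doubling : False.
Proof.
have [K1 HK1] := eventually_affine; have [K2 [n0K2 HK2]] := eventually_large.
pose K := maxn K1 K2.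
have K1K n : (K1 <= K + n)%N by rewrite (leq_trans (leq_maxl K1 K2)) ?leq_addr.
have K2K n : (K2 <= K + n)%N by rewrite (leq_trans (leq_maxr K1 K2)) ?leq_addr.
pose fix u (c : nat -> bool) n :=
  if n is n'.+1 then u c n' + (if c n' then W (K + n') else 0) else 0.
pose P c n x := (s ^+ (K + n) * T (u c n))%g x.
have PS c n x : P c n.+1 x = s (if c n then T (w (K + n)) (P c n x) else P c n x).
  rewrite /P /= addrC TD addnS expgS; case: (c n); last by rewrite T0 mul1g.
  by rewrite !diff1M -[T (w _) _]diff1M sW !diff1M.
have Pl c n : P c n l = (s ^+ (K + n))%g l by rewrite /P diff1M Tl.
have Pr c n : P c n r = (s ^+ (K + n))%g r by rewrite /P diff1M Tr.
pose E := P xpred0 0%N x1 - P xpred0 0%N x0.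
have E0 : 0 < E by rewrite subr_gt0 diff1_lt.
pose D := (s ^+ K)%g r - (s ^+ K)%g l.
have D0 : 0 < D by rewrite subr_gt0 diff1_lt.
have me : 0 < m - e by have := m_gt0; have := e_le_m; lra.
have e2 : 0 < 1 - 2 * e by have := e_le; lra.
pose A := (m - e) * (1 - 2 * e).
have A0 : 0 < A by rewrite mulr_gt0.
have lenP c n : A ^+ n * E <= P c n x1 - P c n x0.
  elim: n => [|n IH]; first by rewrite expr0 mul1r.
  have lP : (s ^+ (K + n))%g l <= P c n x0 by rewrite -(Pl c) diff1_le.
  have Pr' : P c n x1 <= (s ^+ (K + n))%g r by rewrite -(Pr c) diff1_le.
  have P01 : P c n x0 <= P c n x1 by rewrite diff1_le ltW.
  have := HK1 _ (K1K n) _ _ lP P01 Pr' => -[/andP[H1 _] H2].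
  have PT : T (w (K + n)) (P c n x0) <= T (w (K + n)) (P c n x1) by rewrite diff1_le.
  have fixT x : T (W (K + n)) x = x ->
      T (w (K + n)) ((s ^+ (K + n))%g x) = (s ^+ (K + n))%g x.
    by move=> Tx; rewrite -diff1M sW diff1M Tx.
  have lT : (s ^+ (K + n))%g l <= T (w (K + n)) (P c n x0).
    by rewrite -fixT // diff1_le.
  have rT : T (w (K + n)) (P c n x1) <= (s ^+ (K + n))%g r.
    by rewrite -fixT // diff1_le.
  have := HK1 _ (K1K n) _ _ lT PT rT => -[/andP[H3 _] _].
  rewrite !PS exprS -mulrA; apply: (@le_trans _ _ (A * (P c n x1 - P c n x0))).
    by rewrite ler_pM2l.
  rewrite /A -mulrA; case: (c n).
    by apply: le_trans H3; rewrite ler_pM2l.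
  apply: le_trans H1; rewrite ler_pM2l // ler_piMl ?subr_ge0 //.
  by have := e_gt0; lra.
have lenD n : (s ^+ (K + n))%g r - (s ^+ (K + n))%g l <= (m + e) ^+ n * D.
  elim: n => [|n IH]; first by rewrite addn0 expr0 mul1r.
  have lrn : (s ^+ (K + n))%g l <= (s ^+ (K + n))%g r by rewrite diff1_le ltW.
  have := HK1 _ (K1K n) _ _ (lexx _) lrn (lexx _) => -[/andP[_ H] _].
  rewrite addnS expgS !diff1M; apply: le_trans H _.
  by rewrite exprS -mulrA ler_pM2l //; have := e_gt0; have := m_gt0; lra.
pose a i := tau (W (K + i)).
have dbl i : 2 * `|a i| <= `|a i.+1|.
  by rewrite /a addnS; apply: W_double; exact: leq_trans n0K2 (K2K i).
have tau_u c n : tau (u c n) = \sum_(i < n) (c i)%:R * a i.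
  elim: n => [|n IH]; first by rewrite big_ord0.
  by rewrite big_ord_recr /= tauD IH; case: (c n); rewrite ?mul1r // tau0 mul0r.
have sepP c c' n : (exists2 i, (i < n)%N & c i <> c' i) ->
    P c n x1 <= P c' n x0 \/ P c' n x1 <= P c n x0.
  move=> [i lt_in ci].
  pose z i := (c i)%:R - (c' i)%:R : R.
  have z3 i' : [\/ z i' = 0, z i' = 1 | z i' = -1].
    by rewrite /z; case: (c i') (c' i') => [] [];
      rewrite ?subrr ?subr0 ?sub0r;
      [constructor 1|constructor 2|constructor 3|constructor 1].
  have zi : exists2 i, (i < n)%N & z i <> 0.
    by exists i => //; rewrite /z; case: (c i) (c' i) ci => [] [] // _;
      apply/eqP; rewrite ?subr0 ?sub0r ?oppr_eq0 oner_eq0.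
  have [_ /(_ zi)] := doubling_sum n dbl z3.
  have -> : \sum_(i < n) z i * a i = tau (u c n) - tau (u c' n).
    by rewrite !tau_u -sumrB; apply: eq_bigr => j _; rewrite mulrBl.
  move=> le_a.
  have a3 : 3 <= `|a 0%N| by rewrite /a HK2.
  have := le_trans a3 le_a; rewrite ler_normr => /orP[h|h]; [right|left];
    rewrite /P !diff1M diff1_le; apply: tau_sep; lra.
have count n : (2 ^ n)%:R * (A ^+ n * E) <= (m + e) ^+ n * D.
  apply: le_trans (lenD n).
  pose cc (c : {ffun 'I_n -> bool}) i := if insub i is Some i' then c i' else false.
  have -> : (2 ^ n = #|{ffun 'I_n -> bool}|)%N by rewrite card_ffun card_bool card_ord.
  apply: (@card_separated _ _ (fun c => P (cc c) n x0) ((s ^+ (K + n))%g l)).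
  - by rewrite mulr_gt0 ?exprn_gt0.
  - by rewrite subr_ge0 diff1_le ltW.
  - move=> c; have := lenP (cc c) n.
    have : P (cc c) n x1 <= (s ^+ (K + n))%g r by rewrite -(Pr (cc c)) diff1_le.
    have : (s ^+ (K + n))%g l <= P (cc c) n x0 by rewrite -(Pl (cc c)) diff1_le.
    by split; lra.
  - move=> c c' ne; have := lenP (cc c) n; have := lenP (cc c') n.
    suff /sepP : exists2 i, (i < n)%N & cc c i <> cc c' i.
      by move=> [h|h] h1 h2; [left|right]; lra.
    have [i ci] : exists i, c i != c' i.
      by apply/existsP; apply: contraNT ne => /existsPn h; apply/eqP/ffunP => i;
        apply/eqP; rewrite -[_ == _]negbK h.
    by exists i; rewrite ?ltn_ord // /cc valK; exact/eqP.
have ratio : 3 / 2 * (m + e) <= 2 * A.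
  rewrite /A; have := e_le; have := e_le_m; have := e_gt0; have := m_gt0; nra.
have bound n : (3 / 2) ^+ n * E <= D.
  have mep : 0 < (m + e) ^+ n by rewrite exprn_gt0 //; have := e_gt0; have := m_gt0; lra.
  rewrite -(ler_pM2l mep); apply: le_trans (count n).
  rewrite !mulrA ler_pM2r // natrX -!exprMn mulrC.
  by rewrite lerXn2r ?nnegrE // ?mulr_ge0 ?ltW //; have := e_gt0; have := m_gt0; lra.
pose n := (Num.truncn (2 * (D / E))).+1.
have := bound n; rewrite -ler_pdivlMr // => h.
have := le_trans (bernoulli_half R n) h.
by have := truncnS_gt (2 * (D / E)); rewrite -/n; lra.
Qed.

End Mechanism.

(** * Translation numbers *)

Section Homogenization.
Variable R : realType.

Lemma multiples_bounded (y C : R) : (forall k : nat, `|y *+ k.+1| <= C) -> y = 0.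
Proof.
move=> H; apply/eqP/negPn/negP => y0; have ny : 0 < `|y| by rewrite normr_gt0.
have := H (Num.truncn (C / `|y|)); rewrite normrMn -mulr_natl.
by have := truncnS_gt (C / `|y|); rewrite ltr_pdivrMr //; lra.
Qed.

Lemma bounded_morph0 (V : zmodType) (f : V -> R) C :
  {morph f : u v / u + v} -> (forall u, `|f u| <= C) -> forall u, f u = 0.
Proof.
move=> fD fC u; apply: (@multiples_bounded _ C) => k.
suff <- : f (u *+ k.+1) = f u *+ k.+1 by [].
by elim: k => // k IH; rewrite mulrS fD IH -mulrS.
Qed.

(** [tau u] is the limit of [n (k u) / k] as [k] grows. *)
Lemma homogenization (V : zmodType) (n : V -> int) :
  (forall u v, n u + n v <= n (u + v) <= n u + n v + 1) ->
  exists2 tau : V -> R, {morph tau : u v / u + v} &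
    forall u, (n u)%:~R <= tau u <= (n u)%:~R + 1.
Proof.
move=> nD.
have nM u k : n u * k.+1%:Z <= n (u *+ k.+1) <= n u * k.+1%:Z + k%:Z.
  elim: k => [|k IH]; first by rewrite mulr1n; lia.
  rewrite mulrS -[k.+2]addn1 PoszD mulrDr mulr1.
  have := nD u (u *+ k.+1); set A := n u * _ in IH *; set B := n (_ *+ _) in IH *.
  set C := n (_ + _); lia.
pose q u k : R := (n (u *+ k.+1))%:~R / k.+1%:R.
have k1 k : (0 : R) < k.+1%:R by [].
have q_le u j k : q u j <= q u k + k.+1%:R^-1.
  have /andP[H1 _] := nM (u *+ j.+1) k; have /andP[_ H2] := nM (u *+ k.+1) j.
  rewrite -!mulrnA in H1 H2; rewrite [(k.+1 * _)%N]mulnC in H2.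
  have : n (u *+ j.+1) * k.+1 <= (n (u *+ k.+1) + 1) * j.+1 by lia.
  rewrite -(ler_int R) !intrM intrD => H.
  by rewrite /q -[X in _ + X]mul1r -mulrDl ler_pdivrMr // mulrAC ler_pdivlMr.
pose S u : set R := range (q u).
pose tau u := sup (S u).
have Sub u : has_ubound (S u) by exists (q u 0%N + 1%:R^-1) => _ [j _ <-].
have tau_ge u k : q u k <= tau u by apply: (ub_le_sup (Sub u)); exists k.
have tau_le u k : tau u <= q u k + k.+1%:R^-1.
  by apply: ge_sup; [exists (q u 0%N), 0%N | move=> _ [j _ <-]].
have tauM u k : (n (u *+ k.+1))%:~R <= tau u *+ k.+1 <= (n (u *+ k.+1))%:~R + 1.
  rewrite -mulr_natr -ler_pdivrMr // tau_ge /= -ler_pdivlMr //.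
  by rewrite mulrDl div1r; exact: tau_le.
exists tau => [u v|u]; last by have := tauM u 0%N; rewrite !mulr1n.
apply/eqP; rewrite -subr_eq0; apply/eqP; apply: (@multiples_bounded _ 3) => k.
have := tauM (u + v) k; have := tauM u k; have := tauM v k.
have := nD (u *+ k.+1) (v *+ k.+1); rewrite -mulrnDl -!(ler_int R) !intrD.
by rewrite mulrnBl mulrnDl ler_norml; lra.
Qed.

End Homogenization.

Section Hull.
Variables (R : realType) (T : 'cV[int]_2 -> diff1 R).
Hypothesis TD : forall u v, T (u + v) = (T u * T v)%g.
Implicit Types (x y : R) (u v w : 'cV[int]_2).

Lemma action0 : T 0 = 1%g.
Proof. by apply: (mulgI (T 0)); rewrite -TD addr0 mulg1. Qed.

Lemma actionN v : T (- v) = (T v)^-1%g.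
Proof. by apply: (mulgI (T v)); rewrite -TD subrr action0 mulgV. Qed.

Lemma actionK v : cancel (T v) (T (- v)).
Proof. by move=> x; rewrite actionN diff1K. Qed.

Lemma action_fixz v x (a : int) : T v x = x -> T (v *~ a) x = x.
Proof.
move=> vx; have H n : T (v *+ n) x = x.
  by elim: n => [|n IH]; rewrite ?mulr0n ?action0 // mulrS TD diff1M IH.
case: a => n; first exact: H.
by rewrite NegzE mulrNz -pmulrn -{1}(H n.+1) actionK.
Qed.

Definition orbit x : set R := range (fun v => T v x).

(** The convex hull of the orbit of [x] is the interval from [hull_inf x] to
    [hull_sup x]. *)
Definition hull_sup x := sup (orbit x).
Definition hull_inf x := inf (orbit x).

Lemma orbit_sup x : 0 < x < 1 -> has_sup (orbit x).
Proof.
move=> xI; split; first by exists (T 0 x), 0.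
by exists 1 => _ [v _ <-]; have := diff1_in (T v) xI; lra.
Qed.

Lemma orbit_inf x : 0 < x < 1 -> has_inf (orbit x).
Proof.
move=> xI; split; first by exists (T 0 x), 0.
by exists 0 => _ [v _ <-]; have := diff1_in (T v) xI; lra.
Qed.

Lemma hull_in x v : 0 < x < 1 -> hull_inf x <= T v x <= hull_sup x.
Proof.
move=> xI; apply/andP; split.
  by apply: ge_inf; [case: (orbit_inf xI) | exists v].
by apply: ub_le_sup; [case: (orbit_sup xI) | exists v].
Qed.

Lemma hull_self x : 0 < x < 1 -> hull_inf x <= x <= hull_sup x.
Proof. by move=> /(hull_in 0); rewrite action0. Qed.

Section Normalizing.
Variables (s : diff1 R) (sigma sigma' : 'cV[int]_2 -> 'cV[int]_2).
Hypotheses (sT : forall v, (s * T v = T (sigma v) * s)%g) (sigmaK : cancel sigma' sigma).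

Lemma orbit_image x : (s @` orbit x)%classic = orbit (s x).
Proof.
apply/seteqP; split=> [_ [_ [v _ <-] <-]|_ [v _ <-]].
  by exists (sigma v); rewrite // -diff1M -sT.
by exists (T (sigma' v) x); [exists (sigma' v) | rewrite -diff1M sT sigmaK].
Qed.

Lemma hull_sup_image x : 0 < x < 1 -> s (hull_sup x) = hull_sup (s x).
Proof. by move=> xI; rewrite /hull_sup -orbit_image diff1_sup //; exact: orbit_sup. Qed.

Lemma hull_inf_image x : 0 < x < 1 -> s (hull_inf x) = hull_inf (s x).
Proof. by move=> xI; rewrite /hull_inf -orbit_image diff1_inf //; exact: orbit_inf. Qed.

End Normalizing.

Lemma actionC u v : (T u * T v = T v * T u)%g.
Proof. by rewrite -!TD addrC. Qed.

Lemma orbit_shift x v : orbit (T v x) = orbit x.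
Proof.
apply/seteqP; split=> _ [u _ <-]; first by exists (u + v); rewrite // TD diff1M.
by exists (u - v); rewrite // TD diff1M actionK.
Qed.

Lemma hull_sup_fixed x v : 0 < x < 1 -> T v (hull_sup x) = hull_sup x.
Proof.
move=> xI; rewrite (@hull_sup_image _ id id) // => [|u]; last exact: actionC.
by rewrite /hull_sup orbit_shift.
Qed.

Lemma hull_inf_fixed x v : 0 < x < 1 -> T v (hull_inf x) = hull_inf x.
Proof.
move=> xI; rewrite (@hull_inf_image _ id id) // => [|u]; last exact: actionC.
by rewrite /hull_inf orbit_shift.
Qed.

Lemma hull_bounds x : 0 < x < 1 -> 0 <= hull_inf x /\ hull_sup x <= 1.
Proof.
move=> xI; have [x0 _] := orbit_sup xI.
split; [apply: lb_le_inf | apply: ge_sup] => // _ [v _ <-];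
by have := diff1_in (T v) xI; lra.
Qed.

Lemma hull_point_in x y : 0 < x < 1 -> hull_inf x < y < hull_sup x -> 0 < y < 1.
Proof. by move=> /hull_bounds; lra. Qed.

(** The orbits of [x] and [y] are interleaved. *)
Lemma hull_eq x y : 0 < x < 1 -> hull_inf x < y < hull_sup x ->
  hull_inf y = hull_inf x /\ hull_sup y = hull_sup x.
Proof.
move=> xI yI; have y01 := hull_point_in xI yI; move: yI => /andP[ly yr].
have [_ [u _ <-] yu] : exists2 z, orbit x z & y < z.
  by have [z xz yz] := sup_gt (orbit_sup xI).1 yr; exists z.
have [_ [w _ <-] wy] : exists2 z, orbit x z & z < y.
  by have [z xz yz] := inf_lt (orbit_inf xI).1 ly; exists z.
split; apply/eqP; rewrite eq_le; apply/andP; split.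
- apply: lb_le_inf; first exact: (orbit_inf xI).1.
  move=> _ [v _ <-]; apply: le_trans (_ : T (v - u) y <= _).
    by case/andP: (hull_in (v - u) y01).
  by rewrite -[X in _ <= T v X](actionK u) -diff1M -TD diff1_le ltW.
- apply: lb_le_inf; first exact: (orbit_inf y01).1.
  move=> _ [v _ <-]; apply: le_trans (_ : T (v + w) x <= _).
    by case/andP: (hull_in (v + w) xI).
  by rewrite TD diff1M diff1_le ltW.
- apply: ge_sup; first exact: (orbit_inf y01).1.
  move=> _ [v _ <-]; apply: (le_trans (_ : _ <= T (v + u) x)).
    by rewrite TD diff1M diff1_le ltW.
  by case/andP: (hull_in (v + u) xI).
- apply: ge_sup; first exact: (orbit_inf xI).1.
  move=> _ [v _ <-]; apply: (le_trans (_ : _ <= T (v - w) y)).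
    by rewrite -[X in T v X <= _](actionK w) -diff1M -TD diff1_le ltW.
  by case/andP: (hull_in (v - w) y01).
Qed.

Section TranslationNumber.
Variable x0 : R.
Hypotheses (x0I : 0 < x0 < 1) (x0_moved : exists v, T v x0 <> x0).

Let l := hull_inf x0.
Let r := hull_sup x0.

Lemma hull_strict : l < x0 < r.
Proof.
have [v vx] := x0_moved.
have [u ux] : exists u, x0 < T u x0.
  have [lt|lt|e] := ltgtP x0 (T v x0); [by exists v| |by case: vx].
  by exists (- v); rewrite -(diff1_lt (T v)) -diff1M -TD subrr action0.
have Nux : T (- u) x0 < x0 by rewrite -(diff1_lt (T u)) -diff1M -TD subrr action0.
have /andP[H1 _] := hull_in (- u) x0I; have /andP[_ H2] := hull_in u x0I.
by rewrite (le_lt_trans H1 Nux) (lt_le_trans ux H2).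
Qed.

Let inside y : l < y < r -> 0 < y < 1. Proof. exact: hull_point_in. Qed.

Let Tl v : T v l = l. Proof. exact: hull_inf_fixed. Qed.
Let Tr v : T v r = r. Proof. exact: hull_sup_fixed. Qed.

Let hull_stable v y : l < y < r -> l < T v y < r.
Proof. by rewrite -{2}(Tl v) -{2}(Tr v) !diff1_lt. Qed.

(** If two commuting generators both had fixed points in the hull, the orbit of
    the smaller of these points would stay below the larger one, whereas its
    supremum is the endpoint of the hull. *)
Lemma generator_free : exists d, forall y, l < y < r -> T d y <> y.
Proof.
pose d1 : 'cV[int]_2 := delta_mx 0 0; pose d2 : 'cV[int]_2 := delta_mx 1 0.
have dec v : exists a b : int, v = d1 *~ a + d2 *~ b.
  exists (v 0 0), (v 1 0); apply/matrixP => i j; rewrite ord1 -!scaler_int !mxE !intz /=.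
  by case: i => -[|[|//]] i; rewrite /= ?mulr0 ?mulr1 ?addr0 ?add0r;
    congr (v _ _); apply/val_inj.
have [H1|/existsNP[y1]] := pselect (forall y, l < y < r -> T d1 y <> y).
  by exists d1.
move=> /not_implyP[y1I /contrapT e1]; exists d2 => y2 y2I e2.
have [y12|y21] := leP y1 y2.
  have [_ e] := hull_eq x0I y1I; have : hull_sup y1 <= y2.
    apply: ge_sup; first exact: (orbit_sup (inside y1I)).1.
    move=> _ [v _ <-]; have [a [b ->]] := dec v.
    rewrite addrC TD diff1M (action_fixz a e1) -(action_fixz b e2).
    by rewrite diff1_le.
  by rewrite e -/r; lra.
have [_ e] := hull_eq x0I y2I; have : hull_sup y2 <= y1.
  apply: ge_sup; first exact: (orbit_sup (inside y2I)).1.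
  move=> _ [v _ <-]; have [a [b ->]] := dec v.
  rewrite TD diff1M (action_fixz b e2) -(action_fixz a e1).
  by rewrite diff1_le ltW.
by rewrite e -/r; lra.
Qed.

Lemma generator_positive : exists d, forall y, l < y < r -> y < T d y.
Proof.
have [d dfree] := generator_free; have x0S := hull_strict.
have H y z : l < y < r -> l < z < r -> y < T d y -> T d z < z -> False.
  move=> yI zI dy dz; have [yz|zy] := leP y z.
    by have [x xI] := fixed_between yz (ltW dy) (ltW dz); apply: dfree; lra.
  by have [x xI] := fixed_between' (ltW zy) (ltW dz) (ltW dy); apply: dfree; lra.
have [pos|neg|e] := ltgtP x0 (T d x0); last by case: (dfree _ x0S).
  exists d => y yI; have [//|lt|e] := ltgtP y (T d y); last by case: (dfree _ yI).
  by case: (H _ _ x0S yI pos lt).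
exists (- d) => y yI; rewrite -(diff1_lt (T d)) -diff1M -TD subrr action0.
have [lt|//|e] := ltgtP y (T d y); last by case: (dfree _ yI).
by case: (H _ _ yI x0S lt neg).
Qed.

Section Positive.
Variable v0 : 'cV[int]_2.
Hypothesis v0_pos : forall y, l < y < r -> y < T v0 y.

Let P (n : int) := T (v0 *~ n) x0.

Let P_in n : l < P n < r. Proof. exact/hull_stable/hull_strict. Qed.

Let P_next n : P (n + 1) = T v0 (P n).
Proof. by rewrite /P addrC mulrzDr mulr1z TD. Qed.

Let PS n : P n < P (n + 1). Proof. by rewrite P_next; exact: v0_pos. Qed.

Let P_lt m n : (P m < P n) = (m < n).
Proof.
have H (a : int) (k : nat) : P a < P (a + k.+1%:Z).
  elim: k => [|k IH]; first exact: PS.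
  by apply: lt_trans IH _; rewrite -[k.+2]addn1 PoszD addrA; exact: PS.
have H' a b : a < b -> P a < P b.
  by move=> ab; have -> : b = a + (`|b - a|%N.-1).+1%:Z by lia.
have [/H' //|/H' lt|->] := ltgtP m n; last by rewrite ltxx.
by apply/negbTE; rewrite -leNgt ltW.
Qed.

Let P_le m n : (P m <= P n) = (m <= n).
Proof. by rewrite !leNgt P_lt. Qed.

Let P_unbounded y : l < y < r -> exists n : nat, y < P n.
Proof.
move=> yI; apply: contrapT => /forallNP H.
pose S := range (fun n : nat => P n).
have yS : ubound S y by move=> _ [n _ <-]; rewrite leNgt; exact/negP/H.
have Sub : has_ubound S by exists y.
have zI : l < sup S < r.
  have : sup S <= y by apply: ge_sup => //; exists (P 0%N), 0%N.
  have : P 0%N <= sup S by apply: (ub_le_sup Sub); exists 0%N.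
  by have := P_in 0%N; lra.
have := v0_pos zI; rewrite -[X in X < _](diff1VK (T v0)) diff1_lt ltNge => /negP; apply.
apply: ge_sup; first by exists (P 0%N), 0%N.
move=> _ [n _ <-]; rewrite -(diff1_le (T v0)) diff1VK.
apply: (ub_le_sup Sub); exists n.+1 => //.
by rewrite -P_next; congr P; lia.
Qed.

Let P_unbounded' y : l < y < r -> exists n : nat, P (- n%:Z) <= y.
Proof.
move=> yI; apply: contrapT => /forallNP H.
pose S := range (fun n : nat => P (- n%:Z)).
have yS : lbound S y by move=> _ [n _ <-]; rewrite leNgt; apply/negP => /ltW/H.
have Slb : has_lbound S by exists y.
have zI : l < inf S < r.
  have : y <= inf S by apply: lb_le_inf => //; exists (P 0%N), 0%N; rewrite ?oppr0.
  have : inf S <= P 0%N by apply: (ge_inf Slb); exists 0%N; rewrite ?oppr0.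
  by have := P_in 0%N; lra.
have := v0_pos zI; rewrite ltNge => /negP; apply.
apply: lb_le_inf; first by exists (P 0%N), 0%N; rewrite ?oppr0.
move=> _ [n _ <-].
have -> : P (- n%:Z) = T v0 (P (- n.+1%:Z)).
  by rewrite -P_next; congr P; lia.
by rewrite diff1_le; apply: (ge_inf Slb); exists n.+1.
Qed.

Lemma round y : l < y < r -> exists n : int, P n <= y < P (n + 1).
Proof.
move=> yI; have [N yN] := P_unbounded yI; have [M My] := P_unbounded' yI.
have exm : exists m : nat, y < P (m%:Z - M%:Z).
  by exists (N + M)%N; rewrite PoszD addrK.
case: (ex_minnP exm) => -[|m] ym mmin.
  by move: ym; rewrite sub0r ltNge My.
exists (m%:Z - M%:Z); have -> : m%:Z - M%:Z + 1 = m.+1%:Z - M%:Z by lia.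
rewrite ym andbT leNgt; apply/negP => /mmin; by rewrite ltnn.
Qed.

(** The number [n u] of steps of [T v0] that lead from [x0] to [T u x0], rounded down,
    is additive in [u] up to an error of 1. *)
Lemma translation_number_existence : exists tau : 'cV[int]_2 -> R,
  [/\ {morph tau : u v / u + v}, tau v0 = 1,
      forall u v, T u x0 <= T v x0 -> tau u <= tau v + 1 &
      forall u v, tau u + 3 <= tau v -> T u (T v0 x0) <= T v x0].
Proof.
have /choice[n nP] : forall u, exists n : int, P n <= T u x0 < P (n + 1).
  by move=> u; apply: round; exact/hull_stable/hull_strict.
have PD a b : P (a + b) = T (v0 *~ a) (P b) by rewrite /P mulrzDr TD diff1M.
have nD u v : n u + n v <= n (u + v) <= n u + n v + 1.
  have /andP[u1 u2] := nP u; have /andP[w1 w2] := nP v; have /andP[uv1 uv2] := nP (u + v).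
  have C a b x : T a (T b x) = T b (T a x) by rewrite -!diff1M actionC.
  have lo : P (n u + n v) <= T (u + v) x0.
    rewrite PD TD diff1M; apply: le_trans (_ : T u (P (n v)) <= _).
      by rewrite /P C [X in _ <= X]C diff1_le.
    by rewrite diff1_le.
  have hi : T (u + v) x0 < P ((n u + 1) + (n v + 1)).
    rewrite PD TD diff1M; apply: (lt_trans (_ : _ < T u (P (n v + 1)))).
      by rewrite diff1_lt.
    by rewrite /P C [X in _ < X]C diff1_lt.
  have := le_lt_trans lo uv2; have := le_lt_trans uv1 hi; rewrite !P_lt; lia.
have [tau tauD tau_n] := homogenization R nD.
have n_mono u v : T u x0 <= T v x0 -> n u <= n v.
  move=> uv; have /andP[u1 _] := nP u; have /andP[_ w2] := nP v.
  by have := le_lt_trans u1 (le_lt_trans uv w2); rewrite P_lt; lia.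
have tau0 : tau 0 = 0 by apply: (addrI (tau 0)); rewrite -tauD !addr0.
have tauMn u k : tau (u *+ k) = tau u *+ k.
  by elim: k => [|k IH]; rewrite ?mulr0n // !mulrS tauD IH.
have tau1 : tau v0 = 1.
  apply/eqP; rewrite -subr_eq0; apply/eqP; apply: (@multiples_bounded _ _ 1) => k.
  have nk : n (v0 *+ k.+1) = k.+1%:Z.
    have := nP (v0 *+ k.+1); rewrite pmulrn -/(P _) P_le P_lt; lia.
  have := tau_n (v0 *+ k.+1); rewrite nk tauMn mulrnBl ler_norml.
  by rewrite -[k.+1%:Z%:~R]/(k.+1%:R); lra.
have tau_mono u v : T u x0 <= T v x0 -> tau u <= tau v + 1.
  move=> /n_mono; rewrite -(ler_int R) => uv.
  by have := tau_n u; have := tau_n v; lra.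
exists tau; split=> // u v uv.
have /andP[_ H1] := nP (u + v0); have /andP[H2 _] := nP v.
rewrite -diff1M -TD ltW // (lt_le_trans H1) // (le_trans _ H2) // P_le.
rewrite -(ler_int R) intrD; have := tau_n (u + v0); have := tau_n v.
by rewrite tauD tau1; lra.
Qed.

End Positive.

(** [tau] is the translation number homomorphism of the action on the hull of the
    orbit of [x0], normalised by the generator [v0].  An increasing bijection that
    normalises the action and preserves the hull multiplies [tau] by a constant,
    because it maps the ruler [T (n v0) x0] to the ruler [T (n sigma v0) (s x0)]. *)
Theorem translation_number : exists (tau : 'cV[int]_2 -> R) (x1 : R),
  [/\ {morph tau : u v / u + v}, exists v, tau v <> 0,
      x0 < x1 < r,
      forall u v, tau u + 3 <= tau v -> T u x1 <= T v x0 &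
      forall (s : diff1 R) (sigma : 'cV[int]_2 -> 'cV[int]_2),
        {morph sigma : u v / u + v} ->
        (forall v, (s * T v = T (sigma v) * s)%g) -> s l = l -> s r = r ->
        exists c, forall u, tau (sigma u) = c * tau u].
Proof.
have [v0 v0_pos] := generator_positive.
have [tau [tauD tau1 tau_mono tau_sep]] := translation_number_existence v0_pos.
have x0S := hull_strict.
have x1r : T v0 x0 < r.
  by case/andP: (hull_stable v0 x0S).
exists tau, (T v0 x0); split=> //.
- by exists v0; rewrite tau1; apply/eqP; exact: oner_neq0.
- by rewrite x1r v0_pos.
move=> s sigma sigmaD sT sl sr; exists (tau (sigma v0)).
have tau0 : tau 0 = 0 by apply: (addrI (tau 0)); rewrite -tauD !addr0.
have tauN u : tau (- u) = - tau u.
  by apply/eqP; rewrite -addr_eq0 addrC -tauD subrr tau0.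
have sigma0 : sigma 0 = 0 by apply: (addrI (sigma 0)); rewrite -sigmaD !addr0.
have sigmaN u : sigma (- u) = - sigma u.
  by apply/eqP; rewrite -addr_eq0 addrC -sigmaD subrr sigma0.
have zmul (A : zmodType) (f : 'cV[int]_2 -> A) (fD : {morph f : u v / u + v})
    (f0 : f 0 = 0) (fN : forall u, f (- u) = - f u) u a : f (u *~ a) = f u *~ a.
  have H k : f (u *+ k) = f u *+ k.
    by elim: k => [|k IH]; rewrite ?mulr0n // !mulrS fD IH.
  by case: a => k; rewrite ?NegzE ?mulrNz -!pmulrn ?fN H.
have sx0S : l < s x0 < r by rewrite -{1}sl -{1}sr !diff1_lt.
have [c /andP[c1 /ltW c2]] := round v0_pos sx0S.
move=> u; apply/eqP; rewrite -subr_eq0; apply/eqP; move: u.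
apply: (@bounded_morph0 _ _ _ (2 + 3 * `|tau (sigma v0)|)).
  by move=> u v /=; rewrite sigmaD !tauD; ring.
move=> u.
have uS : l < T u x0 < r by exact: hull_stable.
have [n /andP[n1 /ltW n2]] := round v0_pos uS.
have tauz a : tau (v0 *~ a) = a%:~R by rewrite (zmul _ tau) // tau1.
have un : `|tau u - n%:~R| <= 2.
  have := tau_mono _ _ n1; have := tau_mono _ _ n2.
  by rewrite !tauz intrD ler_norml; lra.
have sP a x : s (T (v0 *~ a) x) = T (sigma v0 *~ a) (s x).
  by rewrite -!diff1M sT (zmul _ sigma).
have sTu : s (T u x0) = T (sigma u) (s x0) by rewrite -!diff1M sT.
have lo : n%:~R * tau (sigma v0) <= tau (sigma u) + 2.
  have : T (sigma v0 *~ n + v0 *~ c) x0 <= T (sigma u + v0 *~ (c + 1)) x0.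
    rewrite !TD !diff1M; apply: (@le_trans _ _ (T (sigma v0 *~ n) (s x0))).
      by rewrite diff1_le.
    rewrite -sP; apply: (@le_trans _ _ (T (sigma u) (s x0))); last by rewrite diff1_le.
    by rewrite -sTu diff1_le.
  move=> /tau_mono; rewrite !tauD !tauz (zmul _ tau) // -mulrzl !intrD; lra.
have hi : tau (sigma u) <= (n%:~R + 1) * tau (sigma v0) + 2.
  have : T (sigma u + v0 *~ c) x0 <= T (sigma v0 *~ (n + 1) + v0 *~ (c + 1)) x0.
    rewrite !TD !diff1M; apply: (@le_trans _ _ (T (sigma u) (s x0))).
      by rewrite diff1_le.
    apply: (@le_trans _ _ (T (sigma v0 *~ (n + 1)) (s x0))); last by rewrite diff1_le.
    by rewrite -sTu -sP diff1_le.
  move=> /tau_mono; rewrite !tauD !tauz (zmul _ tau) // -mulrzl !intrD; lra.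
set t := tau (sigma v0) in lo hi *; have : `|t * (tau u - n%:~R)| <= `|t| * 2.
  by rewrite normrM ler_wpM2l.
have := ler_norm t; have := ler_norm (- t); rewrite normrN.
rewrite !ler_norml; have := normr_ge0 t; lra.
Qed.

End TranslationNumber.
End Hull.

(** * Matrices in SL(2, Z) *)

Section Matrix2.
Variable A : comNzRingType.
Implicit Types (M N : 'M[A]_2).

Lemma mulmx2 m n (M : 'M[A]_(m, 2)) (N : 'M[A]_(2, n)) i j :
  (M *m N) i j = M i 0 * N 0 j + M i 1 * N 1 j.
Proof.
rewrite mxE !big_ord_recl big_ord0 addr0.
by rewrite (_ : lift ord0 ord0 = 1) //; apply/val_inj.
Qed.

Lemma mxtrace2 M : \tr M = M 0 0 + M 1 1.
Proof.
rewrite /mxtrace !big_ord_recl big_ord0 addr0.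
by rewrite (_ : lift ord0 ord0 = 1) //; apply/val_inj.
Qed.

Lemma matrix2P M N : M 0 0 = N 0 0 -> M 0 1 = N 0 1 -> M 1 0 = N 1 0 -> M 1 1 = N 1 1 ->
  M = N.
Proof.
move=> e00 e01 e10 e11; apply/matrixP => i j.
have H (k : 'I_2) : (k == 0) || (k == 1) by case: k => -[|[|]].
by case/orP: (H i) => /eqP->; case/orP: (H j) => /eqP->.
Qed.

Lemma colvec2P n (u v : 'M[A]_(2, n)) : u 0 =1 v 0 -> u 1 =1 v 1 -> u = v.
Proof.
move=> e0 e1; apply/matrixP => i j.
have H (k : 'I_2) : (k == 0) || (k == 1) by case: k => -[|[|]].
by case/orP: (H i) => /eqP->.
Qed.

Lemma det2 M : \det M = M 0 0 * M 1 1 - M 0 1 * M 1 0.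
Proof.
rewrite (expand_det_row M 0) !big_ord_recl big_ord0 addr0 /cofactor !det_mx11 !mxE /=.
have l01 : lift ord0 ord0 = 1 :> 'I_2 by exact/val_inj.
have l10 : lift (1 : 'I_2) 0 = 0 by exact/val_inj.
by rewrite !l01 l10 /= addn0 expr0 expr1 mul1r mulN1r mulrN.
Qed.

Lemma cayley_hamilton2 M : M *m M = \tr M *: M - (\det M)%:M.
Proof.
apply: matrix2P; rewrite mulmx2 !mxE mxtrace2 det2 /= ?mulr1n ?mulr0n; ring.
Qed.

End Matrix2.

Section IntegerMatrices.
Implicit Types (M N E : 'M[int]_2) (u v p : 'cV[int]_2).

Definition wedge u v : int := u 0 0 * v 1 0 - u 1 0 * v 0 0.

(** A primitive vector on the line of [u] spans the integer points of this line, so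
    [M] acts on it by a unit of the integers. *)
Lemma rational_eigenvector M u :
  \det M = 1 -> u != 0 -> wedge u (M *m u) = 0 ->
  exists2 k : int, k * k = 1 & M *m u = k *: u /\ \tr M = k + k.
Proof.
rewrite det2 mxtrace2 /wedge !mulmx2 => detM u0.
set a := M 0 0 in detM *; set b := M 0 1 in detM *.
set c := M 1 0 in detM *; set d := M 1 1 in detM *.
set x := u 0 0; set y := u 1 0 => uMu.
pose g := gcdz x y.
have g0 : g != 0.
  rewrite gcdz_eq0; apply: contraNN u0 => /andP[/eqP x0 /eqP y0].
  by apply/eqP/colvec2P => j; rewrite ord1 mxE.
have [r [s rs]] : exists r s, r * x + s * y = g.
  by case: (Bezoutz x y) => r [s rs]; exists r, s.
have /dvdzP[x' xE] : (g %| x)%Z by exact: dvdz_gcdl.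
have /dvdzP[y' yE] : (g %| y)%Z by exact: dvdz_gcdr.
have rs1 : r * x' + s * y' = 1.
  by apply: (mulIf g0); rewrite mul1r -[RHS]rs xE yE; ring.
have w0 : x' * (c * x' + d * y') = y' * (a * x' + b * y').
  apply: (mulIf g0); apply: (mulIf g0).
  by apply/eqP; rewrite -subr_eq0 -[X in _ == X]uMu xE yE; apply/eqP; ring.
pose k : int := r * (a * x' + b * y') + s * (c * x' + d * y').
have k1 : a * x' + b * y' - k * x' = 0.
  have -> : a * x' + b * y' - k * x' = (1 - (r * x' + s * y')) * (a * x' + b * y')
     - s * (x' * (c * x' + d * y') - y' * (a * x' + b * y')) by rewrite /k; ring.
  by rewrite w0 rs1; ring.
have k2 : c * x' + d * y' - k * y' = 0.
  have -> : c * x' + d * y' - k * y' = (1 - (r * x' + s * y')) * (c * x' + d * y')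
     + r * (x' * (c * x' + d * y') - y' * (a * x' + b * y')) by rewrite /k; ring.
  by rewrite w0 rs1; ring.
have kk : k * (a + d - k) = 1.
  have -> : k * (a + d - k) = 1 + (k * (a + d - k) - 1) * (r * x' + s * y').
    by rewrite rs1; ring.
  have -> : 1 + (k * (a + d - k) - 1) * (r * x' + s * y') =
     1 + (a * d - b * c - 1) * (r * x' + s * y')
     + (a * x' + b * y' - k * x') * (r * (k - d) + s * c)
     + (c * x' + d * y' - k * y') * (r * b + s * (k - a)) by ring.
  by rewrite k1 k2 detM; ring.
have kE : k = 1 \/ k = -1.
  have : (absz k * absz (a + d - k)%R)%N = 1%N by rewrite -abszM kk.
  move/eqP; rewrite muln_eq1 => /andP[+ _].
  by case: (k) => [[|[|]]|[|]] // _; [left|right].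
exists k; first by case: kE => ->.
split; last by case: kE kk => -> kk; lia.
apply: colvec2P => j; rewrite ord1 mulmx2 mxE -/a -/b -/c -/d -/x -/y xE yE.
  by apply/eqP; rewrite -subr_eq0 -[X in _ == X](mul0r g) -k1; apply/eqP; ring.
by apply/eqP; rewrite -subr_eq0 -[X in _ == X](mul0r g) -k2; apply/eqP; ring.
Qed.

Definition hyperbolic M := 2 < `|\tr M|.

Lemma hyperbolic_irrational M u :
  \det M = 1 -> hyperbolic M -> wedge u (M *m u) = 0 -> u = 0.
Proof.
move=> detM hM w0; apply/eqP/negPn/negP => u0.
have [k kk [_ trM]] := rational_eigenvector detM u0 w0.
by move: hM; rewrite /hyperbolic trM; nia.
Qed.

(** Both matrices are unipotent with the same fixed line. *)
Lemma common_fixed_commute M N p : p != 0 -> \det M = 1 -> \det N = 1 ->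
  M *m p = p -> N *m p = p -> M *m N = N *m M.
Proof.
rewrite !det2 => p0 detM detN Mp Np.
have := congr1 (fun u : 'cV_2 => u 0 0) Mp; have := congr1 (fun u : 'cV_2 => u 1 0) Mp.
have := congr1 (fun u : 'cV_2 => u 0 0) Np; have := congr1 (fun u : 'cV_2 => u 1 0) Np.
rewrite !mulmx2; set x := p 0 0; set y := p 1 0.
have xy0 : x != 0 \/ y != 0.
  apply/orP; apply: contraNT p0; rewrite negb_or !negbK => /andP[/eqP x0 /eqP y0].
  by apply/eqP/colvec2P => j; rewrite ord1 mxE.
move: detM detN; set a := M 0 0; set b := M 0 1; set c := M 1 0; set d := M 1 1.
set a' := N 0 0; set b' := N 0 1; set c' := N 1 0; set d' := N 1 1.
move=> detM detN n2 n1 m2 m1.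
have tr (e f g h : int) : e * h - f * g = 1 -> e * x + f * y = x -> g * x + h * y = y ->
    e + h = 2.
  move=> E1 E2 E3; have H1 : (2 - e - h) * x = 0.
    have -> : (2 - e - h) * x = (h - 1) * (e * x + f * y - x)
      - (e * h - f * g - 1) * x - f * (g * x + h * y - y) by ring.
    by rewrite E1 E2 E3; ring.
  have H2 : (2 - e - h) * y = 0.
    have -> : (2 - e - h) * y = (e - 1) * (g * x + h * y - y)
      - (e * h - f * g - 1) * y - g * (e * x + f * y - x) by ring.
    by rewrite E1 E2 E3; ring.
  case: xy0 => nz; [move: H1|move: H2] => /eqP; rewrite mulf_eq0 (negPf nz) orbF; lia.
have hM := tr _ _ _ _ detM m1 m2; have hN := tr _ _ _ _ detN n1 n2.
pose e := a - 1; pose e' := a' - 1.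
have [aE dE] : a = 1 + e /\ d = 1 - e by rewrite /e; lia.
have [aE' dE'] : a' = 1 + e' /\ d' = 1 - e' by rewrite /e'; lia.
have {m1}m1 : b * y = - (e * x) by rewrite /e; lia.
have {m2}m2 : c * x = e * y by rewrite /e; lia.
have {n1}n1 : b' * y = - (e' * x) by rewrite /e'; lia.
have {n2}n2 : c' * x = e' * y by rewrite /e'; lia.
have cancel_xy (z : int) : z * x = 0 -> z * y = 0 -> z = 0.
  by case: xy0 => nz /eqP zx /eqP zy; apply/eqP; [move: zx|move: zy];
     rewrite mulf_eq0 (negPf nz) orbF.
have K2 : c * e' - c' * e = 0.
  apply: cancel_xy.
    have -> : (c * e' - c' * e) * x = e' * (c * x) - e * (c' * x) by ring.
    by rewrite m2 n2; ring.
  have -> : (c * e' - c' * e) * y = c * (e' * y) - c' * (e * y) by ring.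
  by rewrite -m2 -n2; ring.
have K1 : e * b' - e' * b = 0.
  apply: cancel_xy.
    have -> : (e * b' - e' * b) * x = - b' * - (e * x) + b * - (e' * x) by ring.
    by rewrite -m1 -n1; ring.
  have -> : (e * b' - e' * b) * y = e * (b' * y) - e' * (b * y) by ring.
  by rewrite m1 n1; ring.
have K3 : b * c' - b' * c = 0.
  apply: cancel_xy.
    have -> : (b * c' - b' * c) * x = b * (c' * x) - b' * (c * x) by ring.
    rewrite m2 n2; have -> : b * (e' * y) - b' * (e * y) = - (e * b' - e' * b) * y by ring.
    by rewrite K1; ring.
  have -> : (b * c' - b' * c) * y = c' * (b * y) - c * (b' * y) by ring.
  rewrite m1 n1; have -> : c' * - (e * x) - c * - (e' * x) = (c * e' - c' * e) * x by ring.
  by rewrite K2; ring.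
apply: matrix2P; rewrite !mulmx2 -/a -/b -/c -/d -/a' -/b' -/c' -/d' ?aE ?dE ?aE' ?dE';
  apply/eqP; rewrite -subr_eq0; apply/eqP.
- by rewrite -[RHS]K3; ring.
- by transitivity ((e * b' - e' * b) * 2); [ring | rewrite K1 mul0r].
- by transitivity ((c * e' - c' * e) * 2); [ring | rewrite K2 mul0r].
- by transitivity (- (b * c' - b' * c)); [ring | rewrite K3 oppr0].
Qed.

(** If [E] is the product of a column [p] by a row [q], with [q p = 0], then both
    sides equal [- (q N p) ^ 2]. *)
Lemma trace_nilpotent_conj E N : \tr E = 0 -> \det E = 0 ->
  \tr (E *m N *m E *m \adj N) = - (\tr (N *m E)) ^+ 2.
Proof.
have l01 : lift ord0 ord0 = 1 :> 'I_2 by exact/val_inj.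
have l10 : lift (1 : 'I_2) 0 = 0 by exact/val_inj.
have [e1 e2 e3 e4] : [/\ \adj N 0 0 = N 1 1, \adj N 0 1 = - N 0 1,
                \adj N 1 0 = - N 1 0 & \adj N 1 1 = N 0 0].
  by rewrite !mxE /cofactor !det_mx11 !mxE /= !l01 !l10; split;
    rewrite ?addn0 ?add0n ?expr0 ?expr1 ?mul1r ?mulN1r // sqrrN expr1n mul1r.
rewrite !mxtrace2 !det2 !mulmx2 e1 e2 e3 e4 => trE.
have -> : E 1 1 = - E 0 0 by apply/eqP; rewrite -addr_eq0 addrC trE.
move=> detE; apply/eqP; rewrite -subr_eq0; apply/eqP.
transitivity ((E 0 0 * - E 0 0 - E 0 1 * E 1 0) *
  (2 * (N 0 0 * N 1 1 - N 0 1 * N 1 0) - (N 0 0 + N 1 1) ^+ 2)); first by ring.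
by rewrite detE mul0r.
Qed.

(** The columns of [E] span its kernel, and [N] preserves the kernel exactly when
    [N E] is nilpotent. *)
Lemma nilpotent_kernel E : E != 0 -> \tr E = 0 -> \det E = 0 ->
  exists2 p : 'cV[int]_2, p != 0 & forall N, \tr (N *m E) = 0 -> wedge p (N *m p) = 0.
Proof.
rewrite !mxtrace2 !det2 => E0 trE detE.
have e11 : E 1 1 = - E 0 0 by apply/eqP; rewrite -addr_eq0 addrC trE.
have : col 0 E != 0 \/ col 1 E != 0.
  apply/orP; apply: contraNT E0; rewrite negb_or !negbK => /andP[/eqP c0 /eqP c1].
  apply/eqP/matrix2P; [have := congr1 (fun u : 'cV_2 => u 0 0) c0
   | have := congr1 (fun u : 'cV_2 => u 0 0) c1
   | have := congr1 (fun u : 'cV_2 => u 1 0) c0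
   | have := congr1 (fun u : 'cV_2 => u 1 0) c1]; by rewrite !mxE.
case=> nz; [exists (col 0 E)|exists (col 1 E)] => // N;
  rewrite mxtrace2 /wedge !mulmx2 !mxE ?e11 => trNE.
  transitivity
    (- E 1 0 * (N 0 0 * E 0 0 + N 0 1 * E 1 0 + (N 1 0 * E 0 1 + N 1 1 * - E 0 0))
    - N 1 0 * (E 0 0 * - E 0 0 - E 0 1 * E 1 0)); first by ring.
  by rewrite trNE -e11 detE; ring.
transitivity
    (E 0 1 * (N 0 0 * E 0 0 + N 0 1 * E 1 0 + (N 1 0 * E 0 1 + N 1 1 * - E 0 0))
    + N 0 1 * (E 0 0 * - E 0 0 - E 0 1 * E 1 0)); first by ring.
by rewrite trNE -e11 detE; ring.
Qed.

End IntegerMatrices.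

(** * Linear forms on the plane *)

Section LinearForms.
Variable R : realType.
Implicit Types (tau : 'cV[int]_2 -> R) (M : 'M[int]_2) (u v : 'cV[int]_2).

Definition eigenform tau M c := forall u, tau (M *m u) = c * tau u.

Lemma linform0 tau : {morph tau : u v / u + v} -> tau 0 = 0.
Proof. by move=> tauD; apply: (addrI (tau 0)); rewrite -tauD !addr0. Qed.

Lemma linformN tau : {morph tau : u v / u + v} -> {morph tau : u / - u}.
Proof.
move=> tauD u; apply/eqP; rewrite -addr_eq0 -tauD addNr.
by rewrite (linform0 tauD).
Qed.

Lemma linformZ tau : {morph tau : u v / u + v} ->
  forall (a : int) u, tau (a *: u) = a%:~R * tau u.
Proof.
move=> tauD; have H (k : nat) u : tau (k%:Z *: u) = k%:R * tau u.
  elim: k => [|k IH]; first by rewrite scale0r mul0r (linform0 tauD).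
  by rewrite -natr1 intS scalerDl scale1r tauD IH mulrDl mul1r addrC.
case=> k u; first exact: H.
by rewrite NegzE scaleNr (linformN tauD) H -mulNr rmorphN.
Qed.

Lemma linformE tau : {morph tau : u v / u + v} -> forall u,
  tau u = (u 0 0)%:~R * tau (delta_mx 0 0) + (u 1 0)%:~R * tau (delta_mx 1 0).
Proof.
move=> tauD u; rewrite -!linformZ // -tauD; congr tau.
by apply: colvec2P => j; rewrite ord1 !mxE /= ?mulr0 ?mulr1 ?addr0 ?add0r.
Qed.

(** The kernel of [tau] would contain [u] and [M u]. *)
Lemma eigenform_irrational tau M c u :
  {morph tau : u v / u + v} -> (exists v, tau v <> 0) -> \det M = 1 -> hyperbolic M ->
  eigenform tau M c -> tau u = 0 -> u = 0.
Proof.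
move=> tauD [v tv] detM hM tauM tu; apply: (hyperbolic_irrational detM hM).
have tMu : tau (M *m u) = 0 by rewrite tauM tu mulr0.
move: tu tMu; rewrite (linformE tauD u) (linformE tauD (M *m u)).
set t1 := tau (delta_mx 0 0); set t2 := tau (delta_mx 1 0) => tu tMu.
apply/eqP/negPn/negP; rewrite -(intr_eq0 R) /wedge => w0; apply: tv.
have e1 : t1 = 0.
  apply: (mulfI w0); rewrite mulr0 rmorphB !rmorphM /=.
  transitivity (((M *m u) 1 0)%:~R * ((u 0 0)%:~R * t1 + (u 1 0)%:~R * t2)
    - (u 1 0)%:~R * (((M *m u) 0 0)%:~R * t1 + ((M *m u) 1 0)%:~R * t2)); first by ring.
  by rewrite tu tMu !mulr0 subrr.
have e2 : t2 = 0.
  apply: (mulfI w0); rewrite mulr0 rmorphB !rmorphM /=.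
  transitivity ((u 0 0)%:~R * (((M *m u) 0 0)%:~R * t1 + ((M *m u) 1 0)%:~R * t2)
    - ((M *m u) 0 0)%:~R * ((u 0 0)%:~R * t1 + (u 1 0)%:~R * t2)); first by ring.
  by rewrite tu tMu !mulr0 subrr.
by rewrite (linformE tauD v) -/t1 -/t2 e1 e2 !mulr0 addr0.
Qed.

Lemma eigenform_charpoly tau M c :
  {morph tau : u v / u + v} -> (exists v, tau v <> 0) -> \det M = 1 ->
  eigenform tau M c -> c * c = (\tr M)%:~R * c - 1.
Proof.
move=> tauD [v /eqP tv] detM tauM; apply: (mulIf tv).
rewrite -mulrA -!tauM mulmxA cayley_hamilton2 detM mulmxBl mul1mx tauD (linformN tauD).
by rewrite -scalemxAl (linformZ tauD) tauM; ring.
Qed.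

(** The combination of [tau] and [tau'] that vanishes at an integer point is an
    eigenform of [M], hence zero. *)
Lemma eigenform_proportional tau tau' M c :
  {morph tau : u v / u + v} -> {morph tau' : u v / u + v} -> (exists v, tau v <> 0) ->
  \det M = 1 -> hyperbolic M -> eigenform tau M c -> eigenform tau' M c ->
  exists k, forall u, tau' u = k * tau u.
Proof.
move=> tauD tauD' [v tv] detM hM tauM tauM'; exists (tau' v / tau v).
pose rho u := tau' u - tau' v / tau v * tau u.
have rhoD : {morph rho : u v / u + v} by move=> a b; rewrite /rho tauD tauD'; ring.
have rhoM : eigenform rho M c by move=> u; rewrite /rho tauM tauM'; ring.
move=> u; apply/eqP; rewrite -subr_eq0; apply/negPn/negP => ru.
apply: (tv); suff -> : v = 0 by rewrite (linform0 tauD).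
apply: (eigenform_irrational rhoD _ detM hM rhoM); first by exists u; exact/eqP.
by rewrite /rho divfK ?subrr //; exact/eqP.
Qed.

(** The larger of [|x n|] and [|y n|] cannot decrease forever, for then it would tend
    to 0, while [x n * y n.+1 - x n.+1 * y n] is constant and nonzero.  Once it does
    not decrease, the recurrence makes it double at each step. *)
Lemma recurrence_growth (x y : nat -> R) (t : R) :
  3 <= `|t| -> (forall n, x n.+2 = t * x n.+1 - x n) ->
  (forall n, y n.+2 = t * y n.+1 - y n) ->
  x 0%N * y 1%N - x 1%N * y 0%N <> 0 ->
  let N n := Num.max `|x n| `|y n| in
  (forall n, 0 < N n) /\ exists n0, forall n, (n0 <= n)%N -> 2 * N n <= N n.+1.
Proof.
move=> t3 xS yS w0 N.
have w n : x n * y n.+1 - x n.+1 * y n = x 0%N * y 1%N - x 1%N * y 0%N.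
  by elim: n => // n <-; rewrite xS yS; ring.
have xN n : `|x n| <= N n by rewrite le_max lexx.
have yN n : `|y n| <= N n by rewrite le_max lexx orbT.
have N0 n : 0 <= N n by apply: le_trans (xN n).
have Npos n : 0 < N n.
  rewrite lt_neqAle N0 andbT eq_sym; apply/eqP => Nn; apply: w0; rewrite -(w n).
  have := xN n; have := yN n; rewrite Nn !normr_le0 => /eqP-> /eqP->.
  by rewrite mul0r mulr0 subrr.
have step n : 3 * N n.+1 <= N n.+2 + N n.
  have lem (z : nat -> R) : z n.+2 = t * z n.+1 - z n ->
      3 * `|z n.+1| <= `|z n.+2| + `|z n|.
    move=> zS; apply: le_trans (ler_normD _ _); rewrite zS subrK normrM.
    by rewrite ler_wpM2r.
  have [e|e] : N n.+1 = `|x n.+1| \/ N n.+1 = `|y n.+1|.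
    by rewrite /N /Num.max; case: ifP => _; [right|left].
  - by rewrite e; apply: le_trans (lem x (xS n)) _; exact: lerD.
  - by rewrite e; apply: le_trans (lem y (yS n)) _; exact: lerD.
split=> //; have [[n0 grow]|dec] := pselect (exists n0, N n0 <= N n0.+1).
  exists n0.+1 => n lt_n; rewrite -(subnKC lt_n) addSn.
  suff : N (n0 + (n - n0.+1))%N <= N (n0 + (n - n0.+1)).+1.
    by have := step (n0 + (n - n0.+1))%N; lra.
  elim: (n - n0.+1)%N => [|k IH]; first by rewrite addn0.
  by rewrite addnS; have := step (n0 + k)%N; have := N0 (n0 + k).+1; lra.
exfalso; have {}dec n : N n.+1 < N n.
  by rewrite ltNge; apply/negP => le; apply: dec; exists n.
have half n : 2 * N n.+1 <= N n by have := step n; have := dec n.+1; lra.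
have small n : (1 + n%:R) * N n <= N 0%N.
  elim: n => [|n IH]; first by rewrite addr0 mul1r.
  by rewrite -natr1; have := half n; have := N0 n.+1; have := ler0n R n; nra.
apply/w0/(@multiples_bounded _ _ (N 0%N * N 0%N)) => k.
rewrite normrMn -mulr_natl -natr1 addrC -(w k).
have le_w : `|x k * y k.+1 - x k.+1 * y k| <= N k * N k.
  apply: le_trans (ler_normB _ _) _; rewrite !normrM.
  apply: (@le_trans _ _ (N k * N k.+1 + N k.+1 * N k)).
    by apply: lerD; apply: ler_pM.
  by have -> : N k * N k.+1 + N k.+1 * N k = 2 * N k.+1 * N k; [ring | rewrite ler_wpM2r].
have sk := small k; have k0 := ler0n R k; have nk := N0 k; have n0 := N0 0%N.
apply: (@le_trans _ _ ((1 + k%:R) * (N k * N k))); first by rewrite ler_wpM2l //; lra.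
have k1 : 0 <= (1 + k%:R) * N k by rewrite mulr_ge0 //; lra.
rewrite mulrA ler_pM //; apply: le_trans sk; rewrite ler_peMl //; lra.
Qed.

End LinearForms.

(** * Subgroups of SL(2, Z) acting on the interval *)

Section SubgroupsOfSL2Z.
Variable F : groupClosed SL2Z.
Implicit Types (f g h a b : subgroup_of F) (u v : 'cV[int]_2).

Definition mat g : 'M[int]_2 := (val g : SL2Z).

Lemma actE g v : act g v = mat g *m v. Proof. by []. Qed.

Lemma matM g h : mat (g * h)%g = mat g *m mat h.
Proof. by rewrite /mat valM. Qed.

Lemma mat1 : mat 1%g = 1%:M.
Proof. by rewrite /mat val1. Qed.

Lemma mat_det g : \det (mat g) = 1. Proof. exact: SL2Z_det. Qed.

Lemma mat_adj g : mat g *m \adj (mat g) = 1%:M.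
Proof. by rewrite mul_mx_adj mat_det. Qed.

Lemma matVm g : mat (g^-1)%g *m mat g = 1%:M.
Proof. by rewrite -matM mulVg mat1. Qed.

Lemma matV g : mat (g^-1)%g = \adj (mat g).
Proof. by rewrite -[LHS]mulmx1 -(mat_adj g) mulmxA matVm mul1mx. Qed.

Lemma mat_inj : injective mat.
Proof. by move=> g h e; apply/val_inj/val_inj. Qed.

Lemma mat_trV g : \tr (mat (g^-1)%g) = \tr (mat g).
Proof.
have e : mat g *m mat (g^-1)%g = 1%:M by rewrite -matM mulgV mat1.
have := cayley_hamilton2 (mat g); rewrite mat_det => H.
have : mat g = \tr (mat g) *: 1%:M - mat (g^-1)%g.
  have /(congr1 (fun M => M *m mat (g^-1)%g)) := H.
  by rewrite mulmxBl -mulmxA e mulmx1 mul1mx -scalemxAl e.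
move/(congr1 mxtrace); rewrite mxtraceD raddfN /= mxtraceZ mxtrace1.
by move: (\tr _ : int) (\tr _ : int) => t t'; lia.
Qed.

Lemma mat_trJ g h : \tr (mat (h * g * h^-1)%g) = \tr (mat g).
Proof. by rewrite !matM mxtrace_mulC mulmxA -matM mulVg mat1 mul1mx. Qed.

Lemma free_not_commute : free_of_rank 2 (subgroup_of F) ->
  exists a b, ~ commute (a * a)%g (b * b)%g.
Proof.
move=> [X X_free]; exists (X 0), (X 1) => e.
pose w (i : 'I_2) : seq ('I_2 * bool) := [:: (i, false); (i, false)].
have wv i j : word_val X (w i ++ w j) = (X i * X i * (X j * X j))%g.
  by rewrite /word_val /= !big_cons big_nil /letter_val /= mulg1 !mulgA.
have : w 0 ++ w 1 = w 1 ++ w 0 by apply: (reduced_inj X_free); rewrite ?wv.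
by [].
Qed.

Section HyperbolicFixedPoint.
Variables (R : realType) (rho : subgroup_of F -> diff1 R).
Hypotheses (rhoM : {morph rho : g h / (g * h)%g})
  (rho_faithful : forall g, rho g = 1%g -> g = 1%g).
Variables a b : subgroup_of F.
Hypothesis ab : ~ commute (a * a)%g (b * b)%g.

Let rho1 : rho 1%g = 1%g.
Proof. by apply: (mulgI (rho 1%g)); rewrite -rhoM !mulg1. Qed.

Let rhoX g n : rho (g ^+ n)%g = (rho g ^+ n)%g.
Proof. by elim: n => [|n IH]; rewrite ?expg0 ?rho1 // !expgS rhoM IH. Qed.

Let rhoV g : rho (g^-1)%g = ((rho g)^-1)%g.
Proof. by apply: (mulgI (rho g)); rewrite -rhoM !mulgV rho1. Qed.

Let torsion_free g n : (g ^+ n.+1 = 1)%g -> g = 1%g.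
Proof.
by move=> e; apply/rho_faithful/(@diff1_torsion_free _ _ n); rewrite -rhoX e rho1.
Qed.

(** A non-trivial element that is not hyperbolic is parabolic up to sign, since
    elliptic elements of SL(2, Z) have finite order. *)
Lemma parabolic_square g : g <> 1%g -> ~ hyperbolic (mat g) ->
  exists E : 'M[int]_2, [/\ mat (g * g)%g = 1%:M + E, E != 0,
                            \tr E = 0, \det E = 0 & E *m E = 0].
Proof.
move=> g1 nh; set M := mat g; have MM := cayley_hamilton2 M; rewrite mat_det in MM.
have [t ht] : exists t, t = \tr M by exists (\tr M).
rewrite -ht in MM; move: nh; rewrite /hyperbolic -/M -ht => /negP; rewrite -leNgt => t2.
have : [\/ t = 0, t = 1, t = -1 | t = 2 \/ t = -2].
  have : (t == 0) || (t == 1) || (t == -1) || (t == 2) || (t == -2) by lia.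
  by move=> /orP[/orP[/orP[/orP[]|]|]|] /eqP; [constructor 1|constructor 2
    |constructor 3|constructor 4; left|constructor 4; right].
case=> [t0|t1|tN1|tt].
- case: g1; apply: (@torsion_free _ 3); apply: mat_inj.
  rewrite !expgS expg0 mulg1 !matM mat1 -/M !mulmxA MM t0 scale0r sub0r.
  by rewrite mulNmx mul1mx mulNmx MM t0 scale0r sub0r opprK.
- case: g1; apply: (@torsion_free _ 5); apply: mat_inj.
  have M3 : M *m M *m M = - 1%:M.
    by rewrite MM t1 scale1r mulmxBl mul1mx MM t1 scale1r addrAC subrr add0r.
  rewrite !expgS expg0 mulg1 !matM mat1 -/M !mulmxA M3.
  by rewrite !mulNmx mul1mx M3 opprK.
- case: g1; apply: (@torsion_free _ 2); apply: mat_inj.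
  rewrite !expgS expg0 mulg1 !matM mat1 -/M !mulmxA MM tN1 scaleN1r.
  by rewrite mulmxBl mulNmx mul1mx MM tN1 scaleN1r opprB opprK addrK.
exists (M *m M - 1%:M).
have E2 : M *m M - 1%:M = t *: M - 2 *: 1%:M.
  by rewrite MM -addrA -opprD -{1 2}[1%:M]scale1r -scalerDl.
have tt4 : t * t = 4 by case: tt => ->.
have trE : \tr (M *m M - 1%:M) = 0.
  rewrite E2 mxtraceD raddfN /= !mxtraceZ mxtrace1 -ht tt4; lia.
have detE : \det (M *m M - 1%:M) = 0.
  rewrite E2; have := mat_det g; rewrite -/M !det2 !mxE /= => detM.
  transitivity (t * t * (M 0 0 * M 1 1 - M 0 1 * M 1 0) - 2 * t * \tr M + 4).
    by rewrite mxtrace2; ring.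
  by rewrite detM -ht -[2 * t * t]mulrA tt4.
split=> //.
- by rewrite matM -/M addrC subrK.
- apply/eqP => /eqP; rewrite subr_eq0 => /eqP M1; case: g1; apply: (@torsion_free _ 1).
  by apply: mat_inj; rewrite expgS expg1 matM M1 mat1.
- by rewrite cayley_hamilton2 trE detE scale0r sub0r raddf0 oppr0.
Qed.

(** Hoelder's theorem provides a non-trivial [g] with a fixed point.  If [g] is
    not hyperbolic, some [h] moves the line fixed by [g ^ 2], for otherwise [a ^ 2] and
    [b ^ 2] would fix this line pointwise and commute; the unipotent elements [g ^ 10]
    and [h g ^ 2 h^-1] then have hyperbolic products, and both have fixed points. *)
Lemma hyperbolic_fixed_point :
  exists f, hyperbolic (mat f) /\ exists2 x, 0 < x < 1 & rho f x = x.
Proof.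
have [g [x [xI gx g1]]] : exists g x, [/\ 0 < x < 1, rho g x = x & g <> 1%g].
  apply: contrapT => H; apply: ab; apply: (@free_action_abelian _ _ rho) => // g x xI gx.
  by apply: contrapT => g1; apply: H; exists g, x.
have [hg|nhg] := pselect (hyperbolic (mat g)); first by exists g; split=> //; exists x.
have [E [gg E0 trE detE EE]] := parabolic_square g1 nhg.
have [h k0] : exists h, \tr (mat h *m E) <> 0.
  apply: contrapT => /forallNP H; apply: ab.
  have {}H c : \tr (mat c *m E) = 0 by apply: contrapT; exact: H.
  have [p p0 Hp] := nilpotent_kernel E0 trE detE.
  have fix2 c : mat (c * c)%g *m p = p.
    have [k kk [e _]] := rational_eigenvector (mat_det c) p0 (Hp _ (H c)).
    by rewrite matM -mulmxA e -scalemxAr e scalerA kk scale1r.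
  apply: mat_inj; rewrite !(matM (_ * _)%g).
  exact: (common_fixed_commute p0 (mat_det _) (mat_det _) (fix2 _) (fix2 _)).
(* With the exponent 5, the traces [2 - 5 k ^ 2] and [2 + 5 k ^ 2] of [p q] and
   [p q^-1] both exceed 2 in absolute value, for any nonzero integer [k]. *)
pose p := ((g * g) ^+ 5)%g; pose q := (h * (g * g) * h^-1)%g.
have px : rho p x = x.
  by rewrite /p rhoX expg_fixed // rhoM diff1M gx.
have qx : rho q (rho h x) = rho h x.
  by rewrite /q !rhoM !diff1M rhoV diff1K !gx.
have hxI : 0 < rho h x < 1 by exact: diff1_in.
have [z zI pqz] := fixed_mul_or_div xI hxI px qx.
have matp : mat p = 1%:M + 5 *: E.
  rewrite /p; suff H n : mat ((g * g) ^+ n)%g = 1%:M + n%:Z *: E by exact: H.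
  elim: n => [|n IH]; first by rewrite expg0 mat1 scale0r addr0.
  rewrite expgS matM IH gg mulmxDl mul1mx mulmxDr mulmx1 -scalemxAr EE scaler0 addr0.
  by rewrite intS scalerDl scale1r addrA addrAC.
have ggV : mat ((g * g)^-1)%g = 1%:M - E.
  have e : mat ((g * g)^-1)%g *m (1%:M + E) = 1%:M by rewrite -gg matVm.
  have e' : (1%:M + E) *m (1%:M - E) = 1%:M.
    by rewrite mulmxDl mul1mx mulmxBr mulmx1 EE subr0 subrK.
  by rewrite -[LHS]mulmx1 -[X in _ *m X = _]e' mulmxA e mul1mx.
set kap := \tr (mat h *m E) in k0.
have trq (e : int) (c : subgroup_of F) : mat c = 1%:M + e *: E ->
    \tr (mat (p * (h * c * h^-1))%g) = 2 - 5 * e * kap ^+ 2.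
  move=> matc; rewrite matM matp (matM (h * c)%g) (matM h) matc matV.
  have -> : mat h *m (1%:M + e *: E) *m \adj (mat h)
      = 1%:M + e *: (mat h *m E *m \adj (mat h)).
    by rewrite mulmxDr mulmx1 mulmxDl mat_adj -scalemxAr -scalemxAl.
  rewrite mulmxDl mul1mx mulmxDr mulmx1 -scalemxAr -!scalemxAl scalerA.
  rewrite !mxtraceD !mxtraceZ mxtrace1 trE !mulmxA trace_nilpotent_conj // -/kap.
  have -> : \tr (mat h *m E *m \adj (mat h)) = 0.
    by rewrite mxtrace_mulC mulmxA -matV matVm mul1mx.
  by ring.
have kk : 0 < kap ^+ 2 by rewrite exprn_even_gt0 //=; exact/eqP.
case: pqz => pqz; [exists (p * q)%g | exists (p * q^-1)%g].
  split; last by exists z; rewrite // rhoM.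
  by rewrite /hyperbolic (trq 1) ?scale1r //; lia.
split; last by exists z; rewrite // rhoM rhoV.
have -> : (q^-1 = h * (g * g)^-1 * h^-1)%g by rewrite /q !invgM invgK !mulgA.
by rewrite /hyperbolic (trq (-1)) ?scaleN1r //; lia.
Qed.

End HyperbolicFixedPoint.

Section NonInvariance.
Variables (R : realType) (tau : 'cV[int]_2 -> R).
Hypotheses (tauD : {morph tau : u v / u + v}) (tau0 : exists v, tau v <> 0).

(** The translates [tau o h] are eigenforms of [f], which has two eigenlines; two of
    [tau], [tau o h], [tau o h ^ 2] are therefore proportional. *)
Lemma eigenform_squares f h : hyperbolic (mat f) ->
  (forall h, exists c, eigenform tau (mat (h * f * h^-1)%g) c) ->
  exists k, eigenform tau (mat (h * h)%g) k.
Proof.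
move=> hf H; pose th g u := tau (mat g *m u).
have thD g : {morph th g : u v / u + v} by move=> u v; rewrite /th mulmxDr tauD.
have th0 g : exists v, th g v <> 0.
  have [v tv] := tau0; exists (mat (g^-1)%g *m v).
  by rewrite /th mulmxA -matM mulgV mat1 mul1mx.
have thf g : exists c, eigenform (th g) (mat f) c.
  have [c Hc] := H g; exists c => u; rewrite /th -Hc !mulmxA -!matM.
  by rewrite -!mulgA mulVg mulg1.
have prop g g' c :=
  @eigenform_proportional _ _ _ (mat f) c (thD g) (thD g') (th0 g) (mat_det f) hf.
have [c1 H1] := thf 1%g; have [c2 H2] := thf h; have [c3 H3] := thf (h * h)%g.
have th1 u : th 1%g u = tau u by rewrite /th mat1 mul1mx.
have E1 := eigenform_charpoly (thD 1%g) (th0 1%g) (mat_det f) H1.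
have E2 := eigenform_charpoly (thD h) (th0 h) (mat_det f) H2.
have E3 := eigenform_charpoly (thD (h * h)%g) (th0 (h * h)%g) (mat_det f) H3.
have sq k : (forall u, tau (mat h *m u) = k * tau u) ->
    exists k, eigenform tau (mat (h * h)%g) k.
  by move=> hk; exists (k * k) => u; rewrite matM -mulmxA !hk mulrA.
have [e|ne12] := eqVneq c1 c2.
  rewrite -e in H2; have [k hk] := prop _ _ _ H1 H2.
  by apply: (sq k) => u; rewrite -(th1 u) -hk.
have [e|ne13] := eqVneq c1 c3.
  rewrite -e in H3; have [k hk] := prop _ _ _ H1 H3.
  by exists k => u; rewrite -(th1 u) -hk.
have e : c2 = c3.
  have s12 : c1 + c2 = (\tr (mat f))%:~R.
    by apply: (mulfI (x := c1 - c2)); [rewrite subr_eq0|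
      rewrite -[LHS]/((c1 - c2) * (c1 + c2)); nra].
  have s13 : c1 + c3 = (\tr (mat f))%:~R.
    by apply: (mulfI (x := c1 - c3)); [rewrite subr_eq0|
      rewrite -[LHS]/((c1 - c3) * (c1 + c3)); nra].
  by apply: (addrI c1); rewrite s12.
rewrite -e in H3; have [k hk] := prop _ _ _ H2 H3.
apply: (sq k) => u; have := hk (mat (h^-1)%g *m u).
by rewrite /th !mulmxA -!matM -mulgA mulgV mulg1 mat1 mul1mx.
Qed.

(** Otherwise [tau] would be an eigenform of [a ^ 2] and of [b ^ 2], so that the
    kernel of [tau] would contain the columns of [a ^ 2 b ^ 2 - b ^ 2 a ^ 2]. *)
Lemma conjugate_not_eigenform f a b : hyperbolic (mat f) ->
  ~ commute (a * a)%g (b * b)%g ->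
  exists h, forall c, ~ eigenform tau (mat (h * f * h^-1)%g) c.
Proof.
move=> hf ab; apply: contrapT => /forallNP H; apply: ab.
have {}H h : exists c, eigenform tau (mat (h * f * h^-1)%g) c.
  by apply: contrapT => /forallNP Hc; exact: (H h).
have [k1 E1] := eigenform_squares a hf H; have [k2 E2] := eigenform_squares b hf H.
have [c Hc] := H 1%g; rewrite mul1g invg1 mulg1 in Hc.
apply: mat_inj; rewrite !(matM (_ * _)%g).
have z u : mat (a * a)%g *m (mat (b * b)%g *m u) = mat (b * b)%g *m (mat (a * a)%g *m u).
  apply/eqP; rewrite -subr_eq0; apply/eqP.
  apply: (eigenform_irrational tauD tau0 (mat_det f) hf Hc).
  by rewrite tauD (linformN tauD) E1 E2 E2 E1; ring.
apply/matrixP => i j; have := congr1 (fun u : 'cV_2 => u i 0) (z (delta_mx j 0)).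
by rewrite !mulmxA -!colE !mxE.
Qed.

Lemma eigenform_of_wedge (tau' : 'cV[int]_2 -> R) : {morph tau' : u v / u + v} ->
  tau (delta_mx 0 0) * tau' (delta_mx 1 0) = tau' (delta_mx 0 0) * tau (delta_mx 1 0) ->
  exists c, forall u, tau' u = c * tau u.
Proof.
move=> tauD'; set t1 := tau (delta_mx 0 0); set t2 := tau (delta_mx 1 0).
set s1 := tau' (delta_mx 0 0); set s2 := tau' (delta_mx 1 0) => w0.
have [t10|t10] := eqVneq t1 0; last first.
  have e : s2 = s1 / t1 * t2 by apply: (mulfI t10); rewrite w0; field.
  exists (s1 / t1) => u; rewrite (linformE tauD' u) (linformE tauD u) -/t1 -/t2 -/s1 -/s2.
  by rewrite e; field.
have [t20|t20] := eqVneq t2 0.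
  by case: tau0 => v; rewrite (linformE tauD v) -/t1 -/t2 t10 t20 !mulr0 addr0.
have s10 : s1 = 0 by apply: (mulIf t20); rewrite -w0 t10 !mul0r.
exists (s2 / t2) => u; rewrite (linformE tauD' u) (linformE tauD u) -/t1 -/t2 -/s1 -/s2.
by rewrite t10 s10; field.
Qed.

End NonInvariance.
End SubgroupsOfSL2Z.

(** * Actions of the semidirect product *)

Section Action.
Variables (R : realType) (F : groupClosed SL2Z).
Variables (T : 'cV[int]_2 -> diff1 R) (A : subgroup_of F -> diff1 R).
Hypotheses (TD : forall u v, T (u + v) = (T u * T v)%g)
  (AM : {morph A : f g / (f * g)%g})
  (AT : forall f v, (A f * T v = T (act f v) * A f)%g).
Implicit Types (f g : subgroup_of F) (u v : 'cV[int]_2).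

Let A1 : A 1%g = 1%g.
Proof. by apply: (mulgI (A 1%g)); rewrite -AM !mulg1. Qed.

Let AV g : A (g^-1)%g = ((A g)^-1)%g.
Proof. by apply: (mulgI (A g)); rewrite -AM !mulgV A1. Qed.

Let AX g n : A (g ^+ n)%g = (A g ^+ n)%g.
Proof. by elim: n => [|n IH]; rewrite ?expg0 ?A1 // !expgS AM IH. Qed.

Variables (x0 x1 : R) (tau : 'cV[int]_2 -> R).
Hypotheses (x0I : 0 < x0 < 1) (tauD : {morph tau : u v / u + v})
  (tau0 : exists v, tau v <> 0) (x01 : x0 < x1 < hull_sup T x0)
  (tau_sep : forall u v, tau u + 3 <= tau v -> T u x1 <= T v x0).

Let l := hull_inf T x0.
Let r := hull_sup T x0.

(** The translations by the vectors of the standard basis serve as [w n] in the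
    mechanism, whichever of them is stretched most by the [n]-th power. *)
Lemma no_contracted_hull g p : hyperbolic (mat g) ->
  (forall c, ~ eigenform tau (mat (g^-1)%g) c) -> 0 < p < 1 ->
  (forall d, 0 < d -> exists K, forall k, (K <= k)%N ->
    p - d < (A g ^+ k)%g l /\ (A g ^+ k)%g r < p + d) -> False.
Proof.
move=> hg neig pI cvg.
pose M := mat (g^-1)%g; pose e1 : 'cV[int]_2 := delta_mx 0 0.
pose e2 : 'cV[int]_2 := delta_mx 1 0.
pose W n v := mat (g^-1 ^+ n)%g *m v.
have W0 v : W 0%N v = v by rewrite /W expg0 mat1 mul1mx.
have W1 v : W 1%N v = M *m v by rewrite /W expg1.
have WS v n : tau (W n.+2 v) = (\tr M)%:~R * tau (W n.+1 v) - tau (W n v).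
  have -> : W n.+2 v = \tr M *: W n.+1 v - W n v.
    rewrite /W !expgS !matM -/M mulmxA cayley_hamilton2 mat_det.
    by rewrite !mulmxBl mul1mx -!scalemxAl.
  by rewrite tauD (linformN tauD) (linformZ tauD).
have t3 : 3 <= `|(\tr M)%:~R : R|.
  by rewrite /M mat_trV -intr_norm -[3]/(3%:~R) ler_int; move: hg; rewrite /hyperbolic; lia.
have w0 : tau (W 0%N e1) * tau (W 1%N e2) - tau (W 1%N e1) * tau (W 0%N e2) <> 0.
  rewrite !W0 !W1 => /eqP; rewrite subr_eq0 => /eqP w0.
  have MD : {morph (fun u => tau (M *m u)) : u v / u + v}.
    by move=> u v; rewrite mulmxDr tauD.
  by have [c Hc] := eigenform_of_wedge tauD tau0 MD w0; exact: (neig c).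
pose N n := Num.max `|tau (W n e1)| `|tau (W n e2)|.
have [Npos [n0 Ndbl]] : (forall n, 0 < N n) /\
    exists n0, forall n, (n0 <= n)%N -> 2 * N n <= N n.+1.
  exact: recurrence_growth t3 (WS e1) (WS e2) w0.
pose w n := if `|tau (W n e1)| < `|tau (W n e2)| then e2 else e1.
have NE n : `|tau (W n (w n))| = N n by rewrite /N /w /Num.max; case: ifP.
have /andP[lx0 x0r] := hull_self TD x0I.
have lr : l < r by have /andP[h1 h2] := x01; rewrite /l /r; lra.
apply: (@no_doubling R _ T (A g) tau l r p x0 x1 e1 e2 w (fun n => W n (w n)) n0) => //.
- by move=> v; exact: hull_inf_fixed.
- by move=> v; exact: hull_sup_fixed.
- by case/andP: x01.
- by case/andP: x01 => _ /ltW.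
- by move=> n; rewrite /w; case: ifP; [right | left].
- move=> n; rewrite -AX AT; congr (T _ * _)%g.
  by rewrite actE /W mulmxA -matM expVgn mulgV mat1 mul1mx.
- by move=> n /eqP; rewrite -normr_eq0 NE gt_eqF.
- by move=> n le_n; rewrite !NE; exact: Ndbl.
Qed.

Hypothesis tau_eigen :
  forall g, A g l = l -> A g r = r -> exists c, eigenform tau (mat g) c.

Let eigenV g c : eigenform tau (mat (g^-1)%g) c -> exists c', eigenform tau (mat g) c'.
Proof.
move=> H; have K u : tau u = c * tau (mat g *m u).
  by rewrite -H mulmxA -matM mulVg mat1 mul1mx.
have c0 : c != 0.
  by apply/eqP => c0; have [v] := tau0; rewrite K c0 mul0r.
by exists c^-1 => u; rewrite (K u) mulKf.
Qed.

(** An element preserving the hull would have [tau] as an eigenform.  Otherwise it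
    moves the hull off itself, and a fixed point, which lies outside of the hull,
    attracts the hull in the past or in the future. *)
Lemma hyperbolic_fixed_eigenform g q : hyperbolic (mat g) -> 0 < q < 1 -> A g q = q ->
  exists c, eigenform tau (mat g) c.
Proof.
move=> hg qI gq; apply: contrapT => neig.
have gxI : 0 < A g x0 < 1 by exact: diff1_in.
have actK : cancel (act (g^-1)%g) (act g).
  by move=> v; rewrite -actM mulgV act1.
have gl : A g l = hull_inf T (A g x0).
  exact: (hull_inf_image (sigma := act g) (sigma' := act (g^-1)%g) (AT g) actK x0I).
have gr : A g r = hull_sup T (A g x0).
  exact: (hull_sup_image (sigma := act g) (sigma' := act (g^-1)%g) (AT g) actK x0I).
have /andP[h1 h2] := x01; have /andP[lx0 x0r] := hull_self TD x0I.
have lr : l < r by rewrite /l /r; lra.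
have disjoint y : l < y < r -> A g l < y < A g r -> False.
  move=> yI; rewrite gl gr => ygI; apply: neig; apply: tau_eigen.
    by rewrite gl -(hull_eq TD gxI ygI).1; exact: (hull_eq TD x0I yI).1.
  by rewrite gr -(hull_eq TD gxI ygI).2; exact: (hull_eq TD x0I yI).2.
have glr : A g l < A g r by rewrite diff1_lt.
have moved : r <= A g l \/ A g r <= l.
  have [le|lt1] := leP r (A g l); first by left.
  have [le|lt2] := leP (A g r) l; first by right.
  exfalso; pose m := Num.max l (A g l); pose n := Num.min r (A g r).
  have mn : m < n by rewrite lt_min !gt_max lr lt1 lt2 glr.
  have lm : l <= m by rewrite le_max lexx.
  have glm : A g l <= m by rewrite le_max lexx orbT.
  have nr : n <= r by rewrite ge_min lexx.
  have ngr : n <= A g r by rewrite ge_min lexx orbT.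
  by apply: (disjoint ((m + n) / 2)); lra.
have outside : q <= l \/ r <= q.
  have [le|lt1] := leP q l; first by left.
  have [le|lt2] := leP r q; first by right.
  exfalso; apply: (disjoint q); first by rewrite lt1.
  by rewrite -gq !diff1_lt lt1.
have [l0 r1] := hull_bounds T x0I.
have neigV c : ~ eigenform tau (mat (g^-1)%g) c by move/eigenV.
have neigVV c : ~ eigenform tau (mat (g^-1^-1)%g) c.
  by rewrite invgK => H; apply: neig; exists c.
have gVq : A (g^-1)%g q = q by rewrite AV -{1}gq diff1K.
have hgV : hyperbolic (mat (g^-1)%g) by rewrite /hyperbolic mat_trV.
have bounds : 0 < r /\ l < 1 by rewrite /l /r; lra.
have Vle x y : (A (g^-1)%g x <= y) = (x <= A g y).
  by rewrite -(diff1_le (A g)) AV diff1VK.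
have leV x y : (x <= A (g^-1)%g y) = (A g x <= y).
  by rewrite -(diff1_le (A g)) AV diff1VK.
case: outside => out; case: moved => mv.
- have [p pI cvg] := iterates_to_fixed_down (s := A (g^-1)%g) lr
    ltac:(by rewrite Vle) out gVq ltac:(by lra) bounds.2.
  exact: (no_contracted_hull hgV neigVV pI cvg).
- have [p pI cvg] := iterates_to_fixed_down lr mv out gq ltac:(by lra) bounds.2.
  exact: (no_contracted_hull hg neigV pI cvg).
- have [p pI cvg] := iterates_to_fixed_up lr mv out gq bounds.1 ltac:(by lra).
  exact: (no_contracted_hull hg neigV pI cvg).
- have [p pI cvg] := iterates_to_fixed_up (s := A (g^-1)%g) lr
    ltac:(by rewrite leV) out gVq bounds.1 ltac:(by lra).
  exact: (no_contracted_hull hgV neigVV pI cvg).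
Qed.

End Action.

Theorem no_embedding (R : realType) (F : groupClosed SL2Z) (a b : subgroup_of F)
    (phi : {multiplicative semidirect F -> diff1 R}) :
  ~ commute (a * a)%g (b * b)%g -> injective phi -> False.
Proof.
move=> ab phi_inj.
have phiM : {morph phi : x y / (x * y)%g} by exact: gmulfM.
pose T v : diff1 R := phi ((v, 1%g) : semidirect F).
pose A f : diff1 R := phi ((0, f) : semidirect F).
have TD u v : T (u + v) = (T u * T v)%g.
  by rewrite /T -phiM; congr (phi (_, _)); rewrite /= ?act1 ?mulg1.
have AM : {morph A : f g / (f * g)%g}.
  by move=> f g; rewrite /A -phiM; congr (phi (_, _)); rewrite /= /act mulmx0 addr0.
have AT f v : (A f * T v = T (act f v) * A f)%g.
  rewrite /A /T -!phiM; congr (phi (_, _)); rewrite /= ?mulg1 ?mul1g //.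
  by rewrite act1 add0r addr0.
have phi1 : phi 1%g = 1%g by apply: (mulgI (phi 1%g)); rewrite -phiM !mulg1.
have A_faithful g : A g = 1%g -> g = 1%g by rewrite -phi1 => /phi_inj[].
have [x0 x0I x0_moved] : exists2 x, 0 < x < 1 & exists v, T v x <> x.
  pose e : 'cV[int]_2 := delta_mx 0 0; apply: contrapT => H.
  have : T e = 1%g.
    apply/val_inj/funext => x /=.
    have [xI|xO] := boolP (x \in `]0, 1[); last exact: diff1_out.
    apply: contrapT => ex; apply: H; exists x; last by exists e.
    by rewrite in_itv in xI.
  by rewrite -phi1 => /phi_inj[] /matrixP/(_ 0 0); rewrite !mxE.
have [tau [x1 [tauD tau0 x01 tau_sep tau_norm]]] := translation_number TD x0I x0_moved.
have [f [hf [q qI fq]]] := hyperbolic_fixed_point AM A_faithful ab.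
have [h neig] := conjugate_not_eigenform tauD tau0 hf ab.
have hh : hyperbolic (mat (h * f * h^-1)%g) by rewrite /hyperbolic mat_trJ.
have fixed : A (h * f * h^-1)%g (A h q) = A h q.
  by rewrite -diff1M -AM mulgVK AM diff1M fq.
have [|c] := hyperbolic_fixed_eigenform TD AM AT x0I tauD tau0 x01 tau_sep _ hh
  (diff1_in (A h) qI) fixed; last exact: neig.
move=> g gl gr; apply: (tau_norm (A g) (act g)) => //.
by move=> u v; exact: actD.
Qed.

Theorem theoremA (R : realType) (F : groupClosed SL2Z)
    (F_free : free_of_rank 2 (subgroup_of F)) :
  locally_indicable (semidirect F) /\
  ~ (exists phi : {multiplicative semidirect F -> diff1 R}, injective phi).
Proof.
split; first exact: locally_indicable_semidirect F_free.
have [a [b ab]] := free_not_commute F_free.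
by case=> phi; exact: no_embedding ab.
Qed.
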